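(* Let $\mathbb{P}$ be the set of all prime numbers. For every $\mathcal{T}\subseteq\mathbb{N}\setminus\{0\}$ and every integer $k\ge0$, $$k!_{\mathbb{P},\mathcal{T}}=\prod_{\substack{b\in\mathcal{T}\\ \varphi(b)+\omega(b)\le k}} b^{\left\lfloor\frac{k-\omega(b)}{\varphi(b)}\right\rfloor+\left\lfloor\frac{k-\omega(b)}{b\varphi(b)}\right\rfloor+\left\lfloor\frac{k-\omega(b)}{b^2\varphi(b)}\right\rfloor+\cdots},$$ where $\varphi$ is Euler's totient function and $\omega(b)$ is the number of distinct prime divisors of $b$.
   Context: $\mathbb{N}=\{0,1,2,\dots\}$. For an integer $b\ge0$ and $a\in\mathbb{Z}$ define $\operatorname{ord}_b(a):=\sup\{k\in\mathbb{N}: a\mathbb{Z}\subseteq b^k\mathbb{Z}\}$ (convention $0^0=1$); thus for $b\ge2$ it is the largest $k$ with $b^k\mid a$ ($+\infty$ for $a=0$), and $\operatorname{ord}_1(a)=+\infty$ for all $a$. For nonempty $S\subseteq\mathbb{Z}$, a $b$-ordering of $S$ is a sequence $(a_i)_{i\ge0}$ in $S$ such that for each $i\ge1$, $a_i$ attains $\min_{a'\in S}\sum_{j=0}^{i-1}\operatorname{ord}_b(a'-a_j)$; the $b$-exponent sequence is $\alpha_k(S,b):=\sum_{j=0}^{k-1}\operatorname{ord}_b(a_k-a_j)$ for any $b$-ordering (independent of the choice). For $\mathcal{T}\subseteq\mathbb{N}$ the generalized factorial is $k!_{S,\mathcal{T}}:=\prod_{b\in\mathcal{T}}b^{\alpha_k(S,b)}$,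 with conventions $b^{+\infty}=0$ for $b=0$ and $b\ge2$, $1^{+\infty}=1$, and $b^0=1$ for all $b\in\mathbb{N}$. *)

(* Defs.v *)
From mathcomp Require Import all_boot all_order all_algebra.
From Stdlib Require Import Classical ClassicalEpsilon.
Set Implicit Arguments. Unset Strict Implicit. Unset Printing Implicit Defensive.
Import GRing.Theory Num.Theory.

(* Extended naturals N ∪ {+oo}: None = +oo. *)
Definition enat := option nat.

Definition eadd (x y : enat) : enat :=
  match x, y with Some m, Some n => Some (m + n)%N | _, _ => None end.

Definition ele (x y : enat) : Prop :=
  match x, y with
  | _, None => True
  | None, Some _ => False
  | Some m, Some n => (m <= n)%N
  end.

Definition esum (n : nat) (f : nat -> enat) : enat :=
  foldr eadd (Some 0%N) (map f (iota 0 n)).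

Lemma not_forall_exists_negb (P : nat -> bool) :
  ~ (forall k, P k) -> exists k, ~~ P k.
Proof.
move=> H; apply: NNPP => H2; apply: H => k; apply: NNPP => Hk.
by apply: H2; exists k; apply/negP.
Qed.

(* ord_b(a) = sup { k in N : a Z ⊆ b^k Z }, i.e. sup { k : b^k | a };
   (a Z ⊆ b^k Z  <->  b^k %| |a| in nat; 0^0 = 1 as in MathComp's expn).
   The set is downward closed, so when it is not all of N its sup is
   (least k with b^k not dividing a) - 1.                                  *)
Definition ord (b : nat) (a : int) : enat :=
  match excluded_middle_informative (forall k, (b ^ k %| `|a|)%N) with
  | left _ => None
  | right H => Some (ex_minn (not_forall_exists_negb
                               (P := fun k => (b ^ k %| `|a|)%N) H)).-1
  end.

Definition ordsum (b : nat) (a : nat -> int) (i : nat) (x : int) : enat :=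
  esum i (fun j => ord b (x - a j)%R).

Definition b_ordering (S : int -> Prop) (b : nat) (a : nat -> int) : Prop :=
  (forall i, S (a i)) /\
  (forall i, (1 <= i)%N -> forall x, S x -> ele (ordsum b a i (a i)) (ordsum b a i x)).

(* alpha_k(S,b), computed along some (chosen) b-ordering; the paper's
   definition is independent of the choice. *)
Definition some_b_ordering (S : int -> Prop) (b : nat) : nat -> int :=
  epsilon (inhabits (fun _ => 0%Z)) (b_ordering S b).

Definition alpha (S : int -> Prop) (b : nat) (k : nat) : enat :=
  ordsum b (some_b_ordering S b) k (some_b_ordering S b k).

Definition epow (b : nat) (x : enat) : nat :=
  match x with Some n => (b ^ n)%N | None => if b == 1%N then 1%N else 0%N end.

Definition nsum_inf (f : nat -> nat) : enat :=
  match excluded_middle_informative (exists N, forall i, (N <= i)%N -> f i = 0%N) with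
  | left H => Some (\sum_(i < proj1_sig (constructive_indefinite_description _ H)) f i)%N
  | right _ => None
  end.

(* Product over a possibly infinite index set P of f:
   fprod_eq P f n  <->  only finitely many b in P have f b <> 1
   and n is the product of f over P (equivalently over those b). *)
Definition fprod_eq (P : nat -> bool) (f : nat -> nat) (n : nat) : Prop :=
  exists s : seq nat, [/\ uniq s, all P s,
    (forall b, P b -> f b != 1%N -> b \in s) & n = (\prod_(b <- s) f b)%N].

Definition genfact_eq (S : int -> Prop) (T : nat -> bool) (k n : nat) : Prop :=
  fprod_eq T (fun b => epow b (alpha S b k)) n.

Definition primesZ (a : int) : Prop := exists p : nat, prime p /\ a = Posz p.

Definition omega (b : nat) : nat := size (primes b).

(* Main.v *)
(* For b >= 2, the primes not dividing b are dense in the units of the b-adic integers (Dirichlet),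
   so a b-ordering of the set of primes uses each of the omega(b) prime divisors of b exactly once,
   and fills the classes of units mod b^m evenly, for all m at once. The first phi(b) + omega(b)
   terms are incongruent mod b; at time k afterwards the next term meets
   floor((k - omega(b)) / (b^(m-1) phi(b))) earlier terms mod b^m, and the exponent is the sum over m.

   Dirichlet's theorem is proved by real-variable methods, without complex characters. Let G be the
   group of units mod b, and let mu be a limit of (sum of Lambda(n)/n over n <= x in the class
   g) / ln x, a probability measure on G. Mertens-type estimates for the functions F on G of mean
   zero give mu * mu + mu = 2/|G|. If mu vanished at some class, then 1 - |G| mu would be a real
   character chi with sum chi(n)/n = 0, which is excluded by an argument of Monsky. *)
Require Import Defs.
From mathcomp Require Import all_boot all_order all_algebra all_fingroup.
From mathcomp Require Import boolp classical_sets filter reals topology normedtype sequences exp.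
From mathcomp Require Import Rstruct.
From mathcomp Require Import ring lra zify.
Set Implicit Arguments. Unset Strict Implicit. Unset Printing Implicit Defensive.
Import Order.TTheory GRing.Theory Num.Theory.
Import numFieldNormedType.Exports.
Local Open Scope ring_scope.

(** * Abel summation and the von Mangoldt function *)

(** The identity [mu * mu + mu = 2/|G|] comes from an operator [Lop] that acts on a character chi as
    multiplication by L(1, chi). Since ln is the divisor sum of Lambda, [mu] annihilates [Lop F] for
    every [F] of mean zero; by Moebius inversion, averaging the shifts of [F] against [mu] gives
    [- F] when [Lop F] vanishes. In Fourier terms, the transform of [mu] at a nontrivial character
    is 0 or -1; the identity says so without naming a character. Since limiting densities are not
    known to exist, [mu] is only a cluster point, and every relation used is an estimate with
    bounded error, which survives division by [ln x].

    In the ordering part, the obstacle is that the greedy choice minimises only the sum over [m] of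
    the counts mod [b^m], whereas evenness is needed for each [m]. Pigeonhole along nested residue
    classes yields one class reaching the floor bound at all levels at once, and Dirichlet puts a
    prime in it. Evenness makes the same floors lower bounds at each level, so a minimal sum forces
    equality level by level. *)

Lemma abel_bound (R : realType) (f w : nat -> R) (B : R) (m n : nat) :
  (m <= n)%N ->
  (forall j, `|\sum_(m <= i < j) f i| <= B) ->
  (forall i, (m <= i)%N -> w i.+1 <= w i) -> (forall i, (m <= i)%N -> 0 <= w i) ->
  `|\sum_(m <= i < n) f i * w i| <= B * w m.
Proof.
move=> mn fB wd w0.
have E : \sum_(m <= i < n) f i * w i =
   (\sum_(m <= i < n) f i) * w n
   + \sum_(m <= i < n) (\sum_(m <= j < i.+1) f j) * (w i - w i.+1).
  elim: n mn => [|n IH] mn.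
    by move: mn; rewrite leqn0 => /eqP ->; rewrite !big_geq // mul0r addr0.
  move: mn; rewrite leq_eqVlt => /orP[/eqP <-|mn].
    by rewrite !big_geq // mul0r addr0.
  by rewrite !(big_nat_recr n) //= ?IH //; ring.
have B0 : 0 <= B by apply: le_trans (fB m).
have wB : \sum_(m <= i < n) (w i - w i.+1) = w m - w n.
  by rewrite -[RHS]opprB -(telescope_sumr _ mn) -sumrN; apply: eq_bigr => i _; rewrite opprB.
rewrite E (le_trans (ler_normD _ _)) // normrM (ger0_norm (w0 n mn)).
have -> : B * w m = B * w n + \sum_(m <= i < n) B * (w i - w i.+1).
  by rewrite -mulr_sumr wB; ring.
apply: lerD; first by rewrite ler_wpM2r // w0.
rewrite (le_trans (ler_norm_sum _ _ _)) // ler_sum_nat // => i /andP[mi _].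
rewrite normrM; have h : 0 <= w i - w i.+1 by rewrite subr_ge0 wd.
by rewrite (ger0_norm h) ler_wpM2r.
Qed.

Lemma sum_dvd_eq (R : realType) (d x : nat) (v : nat -> R) : (0 < d)%N ->
  \sum_(1 <= n < x.+1 | (d %| n)%N) v n = \sum_(1 <= m < (x %/ d).+1%N) v (d * m)%N.
Proof.
move=> d0; elim: x => [|x IH]; first by rewrite div0n !big_geq.
rewrite big_mkcond big_nat_recr //= -big_mkcond /= IH divnS //.
case: ifP => dx; last by rewrite addr0.
rewrite add1n [in RHS]big_nat_recr //=; congr (_ + v _).
have := divnS x d0; rewrite dx add1n => <-.
by rewrite mulnC divnK.
Qed.

Lemma sum_divisors_le (R : realType) (n x : nat) (v : nat -> R) : (0 < n)%N -> (n <= x)%N ->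
  \sum_(1 <= d < n.+1 | (d %| n)%N) v d = \sum_(1 <= d < x.+1 | (d %| n)%N) v d.
Proof.
move=> n0 nx; rewrite [RHS](big_cat_nat _ (n := n.+1)) //=.
rewrite [X in _ + X]big1_seq ?addr0 // => d /andP[dn].
by rewrite mem_index_iota => /andP[nd _]; have := dvdn_leq n0 dn; lia.
Qed.

(** The substitution [n = d * m], behind every exchange of a divisor sum below. *)
Lemma sum_divisors_swap (R : realType) (x : nat) (u : nat -> nat -> R) :
  \sum_(1 <= n < x.+1) \sum_(1 <= d < n.+1 | (d %| n)%N) u d n =
  \sum_(1 <= d < x.+1) \sum_(1 <= m < (x %/ d).+1%N) u d (d * m)%N.
Proof.
rewrite (eq_big_nat _ _ (F2 := fun n => \sum_(1 <= d < x.+1 | (d %| n)%N) u d n)); last first.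
  by move=> n /andP[n0 nx]; apply: sum_divisors_le.
under eq_bigr do rewrite big_mkcond.
rewrite exchange_big /=; apply: eq_big_nat => d /andP[d0 _].
by rewrite -big_mkcond sum_dvd_eq.
Qed.

(** At most one pair [(p, j)] contributes. Both ranges are large enough since [p ^ j = n] with
    [0 < j] forces [p <= n] and [j < n]; finite sums over a common range can then be exchanged
    freely. *)
Definition von_mangoldt (R : realType) (n : nat) : R :=
  \sum_(0 <= p < n.+1) \sum_(0 <= j < n.+1) 
    if prime p && (0 < j)%N && (p ^ j == n)%N then ln p%:R else 0.

Lemma prime_power_bound p j : prime p -> (0 < j)%N -> (p <= p ^ j)%N /\ (j < p ^ j)%N.
Proof.
move=> pp j0; split; last by apply: ltn_expl; apply: prime_gt1.
by rewrite -{1}(expn1 p) leq_pexp2l // prime_gt0.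
Qed.

Lemma von_mangoldt_widen (R : realType) (n N : nat) : (n < N)%N ->
  von_mangoldt R n = \sum_(0 <= p < N) \sum_(0 <= j < N) 
    if prime p && (0 < j)%N && (p ^ j == n)%N then ln p%:R else 0.
Proof.
move=> nN; rewrite [RHS](big_cat_nat _ (n := n.+1)) //=.
rewrite [X in _ + X]big1_seq ?addr0; last first.
  move=> p; rewrite mem_index_iota => /andP[_ /andP[np _]]; apply: big1 => j _.
  case: ifP => // /andP[/andP[pp j0] /eqP e].
  by have [] := prime_power_bound pp j0; lia.
apply: eq_bigr => p _; rewrite [RHS](big_cat_nat _ (n := n.+1)) //=.
rewrite [X in _ + X]big1_seq ?addr0 // => j; rewrite mem_index_iota => /andP[_ /andP[np _]].
case: ifP => // /andP[/andP[pp j0] /eqP e].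
by have [] := prime_power_bound pp j0; lia.
Qed.

Lemma ln_nat_ge0 (R : realType) (n : nat) : 0 <= ln n%:R :> R.
Proof. by case: n => [|n]; [rewrite ln0 | rewrite ln_ge0 // ler1n]. Qed.

Lemma von_mangoldt_ge0 (R : realType) n : 0 <= von_mangoldt R n.
Proof. by apply: sumr_ge0 => p _; apply: sumr_ge0 => j _; case: ifP => // _; apply: ln_nat_ge0. Qed.

Lemma sum_von_mangoldt (R : realType) (N : nat) (P : pred nat) (h : nat -> R) :
  \sum_(1 <= n < N | P n) von_mangoldt R n * h n =
  \sum_(0 <= p < N) \sum_(0 <= j < N)
    if [&& prime p, (0 < j)%N, (p ^ j < N)%N & P (p ^ j)%N] then ln p%:R * h (p ^ j)%N else 0.
Proof.
rewrite big_mkcond /= [LHS](eq_big_nat _ _ (F2 := fun n => \sum_(0 <= p < N) \sum_(0 <= j < N)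
    if prime p && (0 < j)%N && (p ^ j == n)%N then (if P n then ln p%:R * h n else 0) else 0));
  last first.
  move=> n /andP[n0 nN]; case: ifP => Pn; last first.
    by rewrite big1 // => p _; rewrite big1 // => j _; case: ifP.
  rewrite (von_mangoldt_widen R nN) mulr_suml.
  apply: eq_bigr => p _; rewrite mulr_suml; apply: eq_bigr => j _.
  by case: ifP; rewrite ?mul0r.
rewrite exchange_big /=; apply: eq_bigr => p _.
rewrite exchange_big /=; apply: eq_bigr => j _.
case: ifP => [/and4P[pp j0 pN Pp]|H].
  rewrite (bigD1_seq (p ^ j)%N) ?iota_uniq //=; last first.
    by rewrite mem_index_iota pN expn_gt0 prime_gt0.
  rewrite pp j0 eqxx Pp /= big1 ?addr0 // => n /negbTE.
  by rewrite eq_sym => ->.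
rewrite big1_seq // => n; rewrite mem_index_iota => /andP[_ /andP[_ nN]].
case: ifP => // /andP[/andP[pp j0] /eqP e].
by move: H; rewrite pp j0 e nN /= => ->.
Qed.

Lemma ln_nat_eq (R : realType) (n : nat) : (0 < n)%N ->
  ln n%:R = \sum_(0 <= p < n.+1 | prime p) (logn p n)%:R * ln p%:R :> R.
Proof.
move=> n0; rewrite -{1}(partnT n0) /partn.
rewrite (eq_bigl xpredT) // natr_prod.
have key m : ln (\prod_(0 <= p < m) ((p ^ logn p n)%N%:R : R)) = \sum_(0 <= p < m) (logn p n)%:R * ln p%:R
  /\ 0 < \prod_(0 <= p < m) ((p ^ logn p n)%N%:R : R).
  have pos p : 0 < ((p ^ logn p n)%N%:R : R).
    rewrite ltr0n expn_gt0; case: p => // [|p]; rewrite ?lognE ?orbT.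
  elim: m => [|m [IH P]]; first by rewrite !big_geq // ln1 ltr01.
  rewrite !big_nat_recr //=; split; last by rewrite mulr_gt0.
  rewrite lnM ?posrE // IH; congr (_ + _).
  case: m {IH P} => [|m]; first by rewrite lognE /= mul0r ln1.
  by rewrite natrX lnXn ?ltr0n // mulr_natl.
rewrite (proj1 (key _)) [RHS]big_mkcond; apply: eq_bigr => p _ /=.
by case: ifP => // np; rewrite lognE np mul0r.
Qed.

Lemma sum_von_mangoldt_divisors (R : realType) (n : nat) : (0 < n)%N ->
  \sum_(1 <= d < n.+1 | (d %| n)%N) von_mangoldt R d = ln n%:R.
Proof.
move=> n0; under eq_bigr do rewrite -[von_mangoldt R _]mulr1.
rewrite (sum_von_mangoldt _ _ (fun=> 1)) ln_nat_eq // [RHS]big_mkcond.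
apply: eq_bigr => p _ /=; case: ifP => [pp|_]; last by apply: big1.
rewrite (eq_big_nat _ _ (F2 := fun j => if (0 < j <= logn p n)%N then ln p%:R else 0)); last first.
  move=> j _; rewrite mulr1 pfactor_dvdn //; case: (posnP j) => // j0 /=.
  case: (leqP j (logn p n)) => jn; last by rewrite andbF.
  rewrite andbT ltnS dvdn_leq ?pfactor_dvdn //.
have ln' : (logn p n < n.+1)%N.
  by rewrite ltnS ltnW // (leq_trans (ltn_expl _ (prime_gt1 pp))) // dvdn_leq // pfactor_dvdnn.
rewrite (big_cat_nat _ (n := (logn p n).+1)) //= [X in _ + X]big1_seq ?addr0; last first.
  by move=> j; rewrite mem_index_iota => /andP[_ /andP[lj _]]; rewrite [(j <= _)%N]leqNgt lj andbF.
rewrite big_ltn //= add0r (eq_big_nat _ _ (F2 := fun=> ln p%:R)).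
  by rewrite sumr_const_nat subn1 /= mulr_natl.
by move=> j /andP[j0 jl]; rewrite j0 -ltnS jl.
Qed.

(** * Chebyshev and Mertens estimates *)

Lemma ln_fact_sum (R : realType) (n : nat) : ln (n`!)%:R = \sum_(1 <= m < n.+1) ln m%:R :> R.
Proof.
elim: n => [|n IH]; first by rewrite big_geq // ln1.
by rewrite big_nat_recr //= -IH factS natrM mulrC lnM ?posrE ?ltr0n ?fact_gt0.
Qed.

Lemma ln_fact_von_mangoldt (R : realType) (n : nat) :
  ln (n`!)%:R = \sum_(1 <= d < n.+1) von_mangoldt R d * (n %/ d)%:R.
Proof.
rewrite ln_fact_sum.
rewrite (eq_big_nat _ _ (F2 := fun m => \sum_(1 <= d < m.+1 | (d %| m)%N) von_mangoldt R d)).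
  rewrite (sum_divisors_swap n (fun d _ => von_mangoldt R d)).
  by apply: eq_bigr => d _; rewrite sumr_const_nat subn1 mulr_natr.
by move=> m /andP[m0 _]; rewrite sum_von_mangoldt_divisors.
Qed.

Lemma von_mangoldt_le_ln (R : realType) (n : nat) : (0 < n)%N -> von_mangoldt R n <= ln n%:R.
Proof.
move=> n0; rewrite -sum_von_mangoldt_divisors // big_mkcond big_nat_recr //= dvdnn lerDr.
by apply: sumr_ge0 => d _; case: ifP => // _; apply: von_mangoldt_ge0.
Qed.

Lemma bin_double_le (n : nat) : ('C(n.*2, n) <= 4 ^ n)%N.
Proof.
have -> : (4 ^ n = 2 ^ n.*2)%N by rewrite -muln2 mulnC expnM.
have := expnDn 1 1 n.*2; rewrite addn1 => ->.
have nn : (n < n.*2.+1)%N by rewrite ltnS -addnn leq_addr.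
rewrite (bigD1 (Ordinal nn)) //= !exp1n muln1 ?muln1.
exact: leq_addr.
Qed.

Definition chebyshev_psi (R : realType) (n : nat) : R := \sum_(1 <= d < n.+1) von_mangoldt R d.

(** In [ln 'C(2n, n)] the coefficient of Lambda(d) is floor(2n/d) - 2 floor(n/d), which is
    nonnegative and equals 1 for n < d <= 2n. The constant 3 bounds ln 4, as
    ['C(2n, n) <= 4 ^ n]. *)
Lemma chebyshev_psi_double (R : realType) (n : nat) :
  chebyshev_psi R n.*2 <= chebyshev_psi R n + 3 * n%:R.
Proof.
have n2 : (n <= n.*2)%N by rewrite -addnn leq_addr.
have E : ln ('C(n.*2, n))%:R = ln (n.*2)`!%:R - 2 * ln (n`!)%:R :> R.
  have := bin_fact n2; rewrite -{2}addnn addnK => <-.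
  rewrite !natrM !lnM ?posrE ?mulr_gt0 ?ltr0n ?fact_gt0 ?bin_gt0 //; ring.
have H : chebyshev_psi R n.*2 - chebyshev_psi R n <= ln ('C(n.*2, n))%:R.
  rewrite E !ln_fact_von_mangoldt /chebyshev_psi.
  have -> : \sum_(1 <= d < n.+1) von_mangoldt R d * (n %/ d)%:R =
    \sum_(1 <= d < n.*2.+1) von_mangoldt R d * (n %/ d)%:R.
    rewrite [RHS](big_cat_nat _ (n := n.+1)) //= [X in _ + X]big1_seq ?addr0 // => d.
    rewrite mem_index_iota => /andP[_ /andP[nd _]].
    by rewrite divn_small // mulr0.
  rewrite (big_cat_nat _ (n := n.+1)) //= addrAC subrr add0r.
  rewrite mulr_sumr -sumrB [leRHS](big_cat_nat _ (n := n.+1)) //=.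
  rewrite -[leLHS]add0r; apply: lerD.
    rewrite big_seq; apply: sumr_ge0 => d; rewrite mem_index_iota => /andP[d0 _].
    rewrite mulrCA -mulrBr mulr_ge0 ?von_mangoldt_ge0 // subr_ge0 -natrM ler_nat.
    by rewrite -mul2n leq_divRL // -mulnA leq_mul2l leq_divM.
  apply: ler_sum_nat => d /andP[nd dn].
  rewrite [(n %/ d)%N]divn_small // mulr0 mulr0 subr0 ler_peMr ?von_mangoldt_ge0 // ler1n.
  by rewrite divn_gt0 // (leq_ltn_trans _ nd).
have : ln ('C(n.*2, n))%:R <= 3 * n%:R :> R.
  apply: (@le_trans _ _ (ln (4 ^ n)%N%:R)).
    by rewrite ler_ln ?posrE ?ltr0n ?bin_gt0 ?expn_gt0 // ler_nat bin_double_le.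
  rewrite natrX lnXn // -[X in X <= _]mulr_natr ler_wpM2r //.
  have -> : 4 = 1 + 3 :> R by lra.
  by apply: le_ln1Dx; lra.
lra.
Qed.

(** Halving: psi(2m) <= 6m + 3m, and the slack up to 12m pays for the extra term ln(2m+1) <= 2m when
    [n] is odd. *)
Lemma chebyshev_psi_le (R : realType) (n : nat) : chebyshev_psi R n <= 6 * n%:R.
Proof.
elim/ltn_ind: n => n IH.
case: (posnP n) => [->|n0]; first by rewrite /chebyshev_psi big_geq // mulr0.
have [e|o] := boolP (odd n); last first.
  have e2 : n = n./2.*2 by rewrite -[LHS]odd_double_half (negbTE o).
  rewrite e2; apply: le_trans (chebyshev_psi_double _ _) _.
  have := IH n./2 ltac:(lia); rewrite -muln2 natrM; have := ler0n R n./2; lra.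
have e2 : n = n./2.*2.+1 by rewrite -[LHS]odd_double_half e.
rewrite e2 /chebyshev_psi big_nat_recr //=.
have := chebyshev_psi_double R n./2.
rewrite /chebyshev_psi.
have [-> _|m0] := posnP n./2.
  rewrite double0 big_geq // add0r (le_trans (von_mangoldt_le_ln _ _)) // ln1; lra.
have := IH n./2 ltac:(lia); rewrite /chebyshev_psi => h1 h2.
have := von_mangoldt_le_ln R (ltn0Sn n./2.*2).
have : ln (n./2.*2.+1)%:R <= (n./2.*2)%:R :> R.
  by rewrite -natr1 addrC le_ln1Dx // (@lt_le_trans _ _ 0) // oppr_lt0.
move: h1 h2; rewrite -[(n./2.*2.+1)%:R]natr1 -!muln2 !natrM.
have := ler0n R n./2.
lra.
Qed.

Lemma ln_fact_le (R : realType) (n : nat) : ln (n`!)%:R <= n%:R * ln n%:R :> R.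
Proof.
rewrite ln_fact_sum.
apply: (@le_trans _ _ (\sum_(1 <= m < n.+1) ln n%:R)).
  apply: ler_sum_nat => m /andP[m0 mn].
  by rewrite ler_ln ?posrE ?ltr0n ?ler_nat //; lia.
by rewrite sumr_const_nat subn1 /= mulr_natl.
Qed.

Lemma ln_succ_le (R : realType) (n : nat) : (0 < n)%N -> n%:R * (ln n.+1%:R - ln n%:R) <= 1 :> R.
Proof.
move=> n0; have nR : 0 < n%:R :> R by rewrite ltr0n.
rewrite -ln_div ?posrE ?ltr0n //.
have -> : n.+1%:R / n%:R = 1 + n%:R^-1 :> R by rewrite -natr1 mulrDl divff ?gt_eqF // mul1r.
have : ln (1 + n%:R^-1) <= n%:R^-1 :> R.
  by apply: le_ln1Dx; rewrite (@lt_trans _ _ 0) ?invr_gt0 // oppr_lt0.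
by rewrite -(ler_pM2l nR) divff // gt_eqF.
Qed.

Lemma ln_fact_ge (R : realType) (n : nat) : (0 < n)%N -> n%:R * ln n%:R - n%:R <= ln (n`!)%:R :> R.
Proof.
elim: n => // n IH _; have [->|n0] := posnP n; first by rewrite ln1; lra.
have := IH n0; have := ln_succ_le R n0.
rewrite factS natrM lnM ?posrE ?ltr0n ?fact_gt0 //.
by set L := ln n.+1%:R; rewrite -[n.+1%:R]natr1; lra.
Qed.

(** [n * S - ln n!] is the sum of Lambda(d) times the fractional part of n/d, hence lies between 0
    and psi(n) <= 6n; [ln n!] is [n ln n] up to an error of at most [n]. *)
Lemma mertens (R : realType) (n : nat) : (0 < n)%N ->
  `|\sum_(1 <= d < n.+1) von_mangoldt R d / d%:R - ln n%:R| <= 6.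
Proof.
move=> n0; have nR : 0 < n%:R :> R by rewrite ltr0n.
have h1 := ln_fact_le R n; have h2 := ln_fact_ge R n0.
set S := \sum_(_ <= _ < _) _.
have E : n%:R * S - ln (n`!)%:R = \sum_(1 <= d < n.+1) von_mangoldt R d * (n%:R / d%:R - (n %/ d)%:R).
  rewrite ln_fact_von_mangoldt mulr_sumr -sumrB; apply: eq_bigr => d _; ring.
have fr d : (0 < d)%N -> 0 <= (n%:R / d%:R - (n %/ d)%:R : R) <= 1.

  move=> d0; have dR : (0 : R) < d%:R by rewrite ltr0n.
  apply/andP; split.
    by rewrite subr_ge0 ler_pdivlMr // -natrM ler_nat leq_divM.
  rewrite lerBlDr ler_pdivrMr // -[1]/(1%:R) -natrD -natrM ler_nat add1n.
  by rewrite ltnW // ltn_ceil.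
have E1 : 0 <= n%:R * S - ln (n`!)%:R.
  rewrite E big_seq; apply: sumr_ge0 => d; rewrite mem_index_iota => /andP[d0 _].
  by rewrite mulr_ge0 ?von_mangoldt_ge0 //; have /andP[] := fr d d0.
have E2 : n%:R * S - ln (n`!)%:R <= 6 * n%:R.
  apply: le_trans (chebyshev_psi_le R n); rewrite E; apply: ler_sum_nat => d /andP[d0 _].
  by rewrite ler_piMr ?von_mangoldt_ge0 //; have /andP[] := fr d d0.
rewrite ler_norml; apply/andP; split; rewrite -(ler_pM2l nR); lra.
Qed.

Lemma geometric_tail_le (R : realType) (x : R) (N : nat) : 2 <= x ->
  \sum_(2 <= j < N) x ^- j <= 2 / x ^+ 2.
Proof.
move=> x2; have x0 : 0 < x by lra.
have [N2|N2] := leqP N 2; first by rewrite big_geq // divr_ge0 // exprn_ge0 // ltW.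
(* Strengthened for the induction: the subtracted term absorbs the next power because [2 <= x]. *)
suff : \sum_(2 <= j < N) x ^- j <= 2 / x ^+ 2 - 2 / x ^+ N.
  by move/le_trans; apply; rewrite gerBl divr_ge0 // exprn_ge0 // ltW.
elim: N N2 => // N IH; rewrite ltnS leq_eqVlt => /orP[/eqP <-|N2].
  rewrite big_nat1 -subr_ge0.
  have -> : 2 / x ^+ 2 - 2 / x ^+ 3 - x ^- 2 = (x - 2) / x ^+ 3 by field; rewrite gt_eqF.
  by rewrite divr_ge0 ?exprn_ge0 ?subr_ge0 // ltW.
rewrite big_nat_recr ?(ltnW N2) //= (le_trans (lerD (IH N2) (lexx _))) // -subr_ge0.
have -> : 2 / x ^+ 2 - 2 / x ^+ N.+1 - (2 / x ^+ 2 - 2 / x ^+ N + x ^- N) = (x - 2) / x ^+ N.+1.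
  by rewrite [x ^+ N.+1]exprSr; field; rewrite expf_neq0 ?gt_eqF.
by rewrite divr_ge0 ?exprn_ge0 ?subr_ge0 // ltW.
Qed.

(** From ln p <= 2 sqrt p the left side is at most 2 p^(-3/2), which is dominated by a telescoping
    difference. *)
Lemma ln_div_sqr_le (R : realType) (p : nat) : (1 < p)%N ->
  ln p%:R / p%:R ^+ 2 <= 4 * ((Num.sqrt p.-1%:R)^-1 - (Num.sqrt p%:R)^-1) :> R.
Proof.
move=> p1; have pR : 0 < p%:R :> R by rewrite ltr0n; lia.
set s := Num.sqrt p%:R : R; set t := Num.sqrt p.-1%:R : R.
have s0 : 0 < s by rewrite sqrtr_gt0.
have t0 : 0 < t by rewrite sqrtr_gt0 ltr0n; lia.
have s2 : s ^+ 2 = p%:R by rewrite sqr_sqrtr // ltW.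
have t2 : t ^+ 2 = p%:R - 1 by rewrite sqr_sqrtr // -subn1 natrB // ltnW.
have -> : ln p%:R = 2 * ln s by rewrite -s2 lnXn // mulr_natl.
have lns : ln s <= s by apply/ltW/ln_sublinear.
have ts : t <= s by rewrite ler_sqrt ?ler_nat ?leq_pred.
rewrite -s2.
apply: (@le_trans _ _ (2 * s / s ^+ 2 ^+ 2)).
  by rewrite ler_wpM2r ?invr_ge0 ?exprn_ge0 ?(ltW s0) // ler_wpM2l.
have -> : t^-1 - s^-1 = (s - t) / (s * t) by field; rewrite !gt_eqF.
have -> : s - t = 1 / (s + t).
  by apply: (mulIf (x := s + t)); rewrite ?divfK ?gt_eqF ?addr_gt0 // -subr_sqr s2 t2; ring.
have -> : 2 * s / s ^+ 2 ^+ 2 = 2 / s ^+ 3 by field; rewrite gt_eqF.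
have -> : 4 * (1 / (s + t) / (s * t)) = 4 / (s * t * (s + t)).
  by field; rewrite !gt_eqF ?addr_gt0.
rewrite ler_pdivrMr ?exprn_gt0 // mulrAC ler_pdivlMr ?mulr_gt0 ?addr_gt0 //.
have a1 : s * t <= s * s by rewrite ler_wpM2l // ltW.
have a2 : s * t * (s + t) <= s * s * (s + s).
  by apply: ler_pM; rewrite ?lerD2l // ltW // ?mulr_gt0 ?addr_gt0.
have -> : 4 * s ^+ 3 = 2 * (s * s * (s + s)) by ring.
lra.
Qed.

(** The powers [p ^ j] with [j >= 2] contribute at most 2 ln p / p^2 for each [p]; these bounds
    telescope to at most 8. *)
Lemma sum_nonprime_von_mangoldt_le (R : realType) (N : nat) :
  \sum_(1 <= n < N | ~~ prime n) von_mangoldt R n / n%:R <= 8.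
Proof.
rewrite (sum_von_mangoldt _ _ (fun n => n%:R^-1)).
apply: (@le_trans _ _ (\sum_(0 <= p < N | prime p) 2 * (ln p%:R / p%:R ^+ 2))).
  rewrite [leRHS]big_mkcond; apply: ler_sum => p _; case: ifP => pp; last first.
    by rewrite big1.
  have -> : 2 * (ln p%:R / p%:R ^+ 2) = ln p%:R * (2 / p%:R ^+ 2) :> R by ring.
  apply: le_trans (ler_wpM2l (ln_nat_ge0 R p) (geometric_tail_le (x := p%:R) N _)); last first.
    by rewrite ler_nat prime_gt1.
  have [N2|N2] := leqP N 2.
    rewrite [X in _ <= _ * X]big_geq // mulr0 le_eqVlt big1_seq ?eqxx // => j.
    rewrite mem_index_iota => /andP[_ /andP[_ jN]].
    case: ifP => // /and4P[_ j0 pj _].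
    have := prime_power_bound pp j0; have := prime_gt1 pp; lia.
  rewrite (big_cat_nat _ (n := 2)) ?(ltnW N2) //= [X in X + _]big1_seq ?add0r; last first.
    move=> j; rewrite mem_index_iota => /andP[_ /andP[_ j2]].
    case: ifP => // /and3P[j0 _].
    have -> : j = 1%N by lia.
    by rewrite expn1 pp.
  rewrite mulr_sumr; apply: ler_sum => j _; case: ifP => _; first by rewrite natrX.
  by rewrite mulr_ge0 ?ln_nat_ge0 // invr_ge0 exprn_ge0.
have nn p : (1 < p)%N -> 0 <= 8 * ((Num.sqrt p.-1%:R)^-1 - (Num.sqrt p%:R)^-1) :> R.
  move=> p1; rewrite mulr_ge0 // subr_ge0 lef_pV2 ?posrE ?sqrtr_gt0 ?ltr0n; try lia.
  by rewrite ler_sqrt ?ler_nat ?leq_pred.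
have [N2|N2] := leqP N 2.
  rewrite big1_seq // => p; rewrite mem_index_iota => /andP[pp].
  have := prime_gt1 pp; lia.
rewrite big_mkcond (big_cat_nat _ (n := 2)) ?(ltnW N2) //= [X in X + _]big1_seq ?add0r; last first.
  move=> p; rewrite mem_index_iota => /andP[_ p2].
  by case: ifP => // /prime_gt1; lia.
apply: (@le_trans _ _ (\sum_(2 <= p < N) 8 * ((Num.sqrt p.-1%:R)^-1 - (Num.sqrt p%:R)^-1))).
  apply: ler_sum_nat => p /andP[p2 _]; case: ifP => _; last exact: nn.
  by have := ln_div_sqr_le R p2; lra.
rewrite -mulr_sumr.
suff -> : \sum_(2 <= p < N) ((Num.sqrt p.-1%:R)^-1 - (Num.sqrt p%:R)^-1) = 1 - (Num.sqrt N.-1%:R)^-1 :> R.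
  by rewrite ger_pMr // gerBl invr_ge0 sqrtr_ge0.
elim: N N2 {nn} => // N IH; rewrite ltnS leq_eqVlt => /orP[/eqP <-|N2].
  by rewrite big_nat1 /= sqrtr1 invr1.
by rewrite big_nat_recr ?(ltnW N2) //= IH //=; ring.
Qed.

(** * The Moebius function *)

Definition moebius (R : realType) (n : nat) : R :=
  \prod_(p <- primes n) (if logn p n == 1%N then -1 else 0).

Lemma moebius1 (R : realType) : moebius R 1 = 1.
Proof. by rewrite /moebius big_nil. Qed.

Lemma norm_moebius_le (R : realType) (n : nat) : `|moebius R n| <= 1.
Proof.
rewrite /moebius; elim: (primes n) => [|p s IH]; first by rewrite big_nil normr1.
rewrite big_cons normrM -[leRHS]mulr1 ler_pM //.
by case: ifP => _; rewrite ?normrN ?normr1 ?normr0.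
Qed.

Lemma moebius_mul_prime (R : realType) (p n : nat) : prime p -> (0 < n)%N ->
  moebius R (p * n) = if (p %| n)%N then 0 else - moebius R n.
Proof.
move=> pp n0; have p0 := prime_gt0 pp.
have pm : p \in primes (p * n) by rewrite mem_primes pp muln_gt0 p0 n0 dvdn_mulr.
rewrite /moebius (bigD1_seq p) ?primes_uniq //= lognM // logn_prime // eqxx.
have [pn|/negbTE pn] := boolP (p %| n)%N.
  have : (0 < logn p n)%N by rewrite logn_gt0 mem_primes pp n0 pn.
  by case: (logn p n) => // k _; rewrite mul0r.
have -> : logn p n = 0%N by rewrite lognE pp n0 pn.
rewrite mulN1r -big_filter; congr (- _).
apply: etrans (_ : _ = \prod_(q <- primes n) (if logn q (p * n) == 1%N then -1 else 0)) _.
  apply: perm_big; apply: uniq_perm; rewrite ?filter_uniq ?primes_uniq // => q.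
  rewrite mem_filter /= primesM // primes_prime // inE.
  have [->|//] := eqVneq q p.
  by rewrite /= mem_primes pn !andbF.
apply: eq_big_seq => q; rewrite mem_primes => /and3P[qq _ qn].
rewrite lognM // logn_prime //.
by have [e|//] := eqVneq p q; move: pn; rewrite e qn.
Qed.

Lemma sum_moebius_divisors (R : realType) (n : nat) : (0 < n)%N ->
  \sum_(1 <= d < n.+1 | (d %| n)%N) moebius R d = (n == 1%N)%:R.
Proof.
move=> n0; have [->|n1] := eqVneq n 1%N.
  by rewrite big_mkcond big_nat1 dvd1n moebius1.
have n2 : (1 < n)%N by lia.
(* For one prime [p] dividing [n], the divisor [p * e] with [e] prime to [p] cancels against [e];
   multiples of [p ^ 2] contribute 0. *)
set p := pdiv n; have pp : prime p by apply: pdiv_prime.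
have p0 := prime_gt0 pp.
have pn : (p %| n)%N by apply: pdiv_dvd.
rewrite (bigID (fun d => (p %| d)%N)) /=.
have -> : \sum_(1 <= d < n.+1 | (d %| n)%N && (p %| d)%N) moebius R d =
  \sum_(1 <= d < n.+1 | (p %| d)%N) (if (d %| n)%N then moebius R d else 0).
  by rewrite big_mkcondl.
rewrite sum_dvd_eq // (eq_big_nat _ _ (F2 := fun e =>
   if (p * e %| n)%N && ~~ (p %| e)%N then - moebius R e else 0)); last first.
  move=> e /andP[e0 _]; rewrite moebius_mul_prime //.
  by case: (_ %| n)%N => //=; case: (p %| e)%N.
rewrite -big_mkcond sumrN.
have -> : \sum_(1 <= i < n.+1 | (i %| n)%N && ~~ (p %| i)%N) moebius R i =
   \sum_(1 <= e < n.+1 | (p * e %| n)%N && ~~ (p %| e)%N) moebius R e.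
  apply: eq_bigl => e; case pe: (p %| e)%N; rewrite ?andbF // !andbT.
  rewrite Gauss_dvd ?pn // prime_coprime //; by rewrite pe.
rewrite [X in _ + X](big_cat_nat _ (n := (n %/ p).+1)) ?ltnS ?leq_div //=.
rewrite [X in _ + (_ + X)]big1_seq ?addr0; first by rewrite addrC subrr.
move=> e; rewrite mem_index_iota => /andP[/andP[pe _] /andP[e1 _]].
have := dvdn_leq n0 pe; rewrite mulnC -leq_divRL //; lia.
Qed.

(* Moebius inversion of [\sum_(d %| n) von_mangoldt d = ln n], with [ln (n / d)] replaced by
   [ln (x / d)], at the cost of an extra term at [n = 1]. *)
Lemma sum_moebius_ln (R : realType) (x n : nat) : (0 < n)%N -> (0 < x)%N ->
  \sum_(1 <= d < n.+1 | (d %| n)%N) moebius R d * (ln x%:R - ln d%:R) =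
  (n == 1%N)%:R * ln x%:R + von_mangoldt R n.
Proof.
move=> n0 x0.
rewrite (eq_bigr (fun d => moebius R d * (ln x%:R - ln n%:R) +
   (moebius R d * (ln n%:R - ln d%:R)))); last by move=> d _; ring.
rewrite big_split /= -mulr_suml sum_moebius_divisors //.
have -> : (n == 1%N)%:R * (ln x%:R - ln n%:R) = (n == 1%N)%:R * ln x%:R :> R.
  by have [->|_] := eqVneq n 1%N; rewrite ?ln1 ?subr0 ?mul0r.
congr (_ + _).
(* Expand ln(n/d) as the sum of Lambda(e) over [e] dividing n/d. After the exchange, the inner
   Moebius sum over divisors of n/e vanishes unless [e = n]. *)
apply: etrans (_ : _ = \sum_(1 <= d < n.+1) \sum_(1 <= e < n.+1)
   if (d * e %| n)%N then moebius R d * von_mangoldt R e else 0) _.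
  rewrite big_mkcond; apply: eq_big_nat => d /andP[d0 dn].
  case: ifP => dvn; last first.
    by rewrite big1 // => e _; case: ifP => // h; rewrite (dvdn_trans (dvdn_mulr e (dvdnn d)) h) in dvn.
  have q0 : (0 < n %/ d)%N by rewrite divn_gt0 // -ltnS.
  rewrite -ln_div ?posrE ?ltr0n //.
  have -> : n%:R / d%:R = (n %/ d)%:R :> R.
    by rewrite -{1}(divnK dvn) natrM mulfK // pnatr_eq0; lia.
  rewrite -sum_von_mangoldt_divisors // (sum_divisors_le (x := n)) ?leq_div //.
  rewrite big_mkcond mulr_sumr; apply: eq_bigr => e _.
  by rewrite dvdn_divRL // mulnC; case: ifP; rewrite ?mulr0.
rewrite exchange_big /= big_nat_recr //= [X in X + _]big1_seq ?add0r; last first.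
  move=> e; rewrite mem_index_iota => /andP[_ /andP[e0 en]].
  have [ed|ed] := boolP (e %| n)%N; last first.
    rewrite big1 // => d _; case: ifP => // h.
    by rewrite (dvdn_trans (dvdn_mull d (dvdnn e)) h) in ed.
  have q0 : (0 < n %/ e)%N by rewrite divn_gt0 //; lia.
  rewrite (eq_bigr (fun d => (if (d %| n %/ e)%N then moebius R d else 0) * von_mangoldt R e)); last first.
    by move=> d _; rewrite dvdn_divRL //; case: ifP; rewrite ?mul0r.
  rewrite -mulr_suml -big_mkcond -sum_divisors_le ?leq_div // sum_moebius_divisors //.
  have -> : (n %/ e == 1)%N = false; last by rewrite mul0r.
  apply/negbTE/eqP => h; have := divnK ed; rewrite h; lia.
rewrite (eq_bigr (fun d => if (d %| 1)%N then moebius R d * von_mangoldt R n else 0)); last first.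
  by move=> d _; rewrite -[X in (_ %| X)%N](mul1n n) dvdn_pmul2r.
rewrite -big_mkcond -sum_divisors_le //.
by rewrite big_mkcond big_nat1 moebius1 mul1r.
Qed.

(** * Monsky's argument for real characters *)

Definition divisor_sum (R : realType) (chi : nat -> R) (n : nat) : R :=
  \sum_(1 <= d < n.+1 | (d %| n)%N) chi d.

(** Divisors of [p ^ e.+1 * m] are either divisors of [m] or [p] times a divisor of [p ^ e * m]. *)
Lemma divisor_sum_prime_power (R : realType) (chi : nat -> R) (p e m : nat) :
  (forall m n, chi (m * n)%N = chi m * chi n) ->
  prime p -> coprime p m -> (0 < m)%N ->
  divisor_sum chi (p ^ e * m) = (\sum_(i < e.+1) chi p ^+ i) * divisor_sum chi m.
Proof.
move=> chiM pp cpm m0; have p0 := prime_gt0 pp.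
elim: e => [|e IH]; first by rewrite big_ord1 mul1r expn0 mul1n.
have n0 : (0 < p ^ e * m)%N by rewrite muln_gt0 expn_gt0 p0.
rewrite big_ord_recl /= (eq_bigr (fun i : 'I_e.+1 => chi p * chi p ^+ i)); last first.
  by move=> i _; rewrite -exprS.
rewrite -mulr_sumr mulrDl mul1r -mulrA -IH expnS -mulnA.
set n := (p ^ e * m)%N.
rewrite {1}/divisor_sum (bigID (fun d => (p %| d)%N)) /= addrC; congr (_ + _).
  rewrite /divisor_sum (sum_divisors_le (x := (p * n)%N) _ m0); last first.
    by rewrite /n mulnA leq_pmull // muln_gt0 expn_gt0 p0.
  apply: eq_bigl => d; rewrite /n mulnA -expnS -prime_coprime //.
  case cpd: (coprime p d) => /=; last first.
    rewrite andbF; apply/esym/negbTE/negP => dm.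
    by rewrite (coprime_dvdr dm cpm) in cpd.
  by rewrite andbT Gauss_dvdr // coprimeXr // coprime_sym.
rewrite big_mkcondl sum_dvd_eq // mulKn // /divisor_sum mulr_sumr [RHS]big_mkcond.
apply: eq_bigr => d _; rewrite dvdn_pmul2l // chiM.
by case: ifP.
Qed.

Lemma divisor_sum_ge0 (R : realType) (chi : nat -> R) (n : nat) :
  (forall m n, chi (m * n)%N = chi m * chi n) -> chi 1%N = 1 ->
  (forall n, [\/ chi n = 0, chi n = 1 | chi n = -1]) ->
  (0 < n)%N -> 0 <= divisor_sum chi n.
Proof.
move=> chiM chi1 chi3; elim/ltn_ind: n => n IH n0.
have [n1|n1] := leqP n 1.
  have -> : n = 1%N by lia.
  by rewrite /divisor_sum big_mkcond big_nat1 chi1.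
have pp := pdiv_prime n1; have [m cpm E] := pfactor_coprime pp n0.
have m0 : (0 < m)%N by move: n0; rewrite E muln_gt0 => /andP[].
have e0 : (0 < logn (pdiv n) n)%N by rewrite logn_gt0 mem_primes pp n0 pdiv_dvd.
rewrite E mulnC divisor_sum_prime_power // mulr_ge0 //; last first.
  apply: IH => //; rewrite E -[X in (X < _)%N]muln1 ltn_pmul2l //.
  by rewrite -(exp1n (logn (pdiv n) n)) ltn_exp2r // prime_gt1.
case: (chi3 (pdiv n)) => ->.
- by apply: sumr_ge0 => i _; rewrite exprn_ge0.
- by apply: sumr_ge0 => i _; rewrite exprn_ge0.
(* At a prime with [chi p = -1] the local factor alternates between 1 and 0. On squares the number
   of terms is odd, so that the factor is at least 1. *)
have H k : 0 <= \sum_(i < k) (-1) ^+ i :> R.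
  have -> : \sum_(i < k) (-1) ^+ i = (odd k)%:R :> R.
    elim: k => [|k IHk]; first by rewrite big_ord0.
    rewrite big_ord_recr /= IHk -signr_odd; case: (odd k); rewrite /= ?expr1 ?expr0; ring.
  by [].
exact: H.
Qed.

Lemma divisor_sum_sqr_ge1 (R : realType) (chi : nat -> R) (n : nat) :
  (forall m n, chi (m * n)%N = chi m * chi n) -> chi 1%N = 1 ->
  (forall n, [\/ chi n = 0, chi n = 1 | chi n = -1]) ->
  (0 < n)%N -> 1 <= divisor_sum chi (n ^ 2).
Proof.
move=> chiM chi1 chi3; elim/ltn_ind: n => n IH n0.
have [n1|n1] := leqP n 1.
  have -> : n = 1%N by lia.
  by rewrite /divisor_sum big_mkcond big_nat1 chi1.
have pp := pdiv_prime n1; have [m cpm E] := pfactor_coprime pp n0.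
have m0 : (0 < m)%N by move: n0; rewrite E muln_gt0 => /andP[].
have e0 : (0 < logn (pdiv n) n)%N by rewrite logn_gt0 mem_primes pp n0 pdiv_dvd.
rewrite E expnMn mulnC -expnM divisor_sum_prime_power ?coprimeXr ?expn_gt0 ?m0 //.
rewrite -[leLHS]mulr1 ler_pM //; last first.
  apply: IH => //; rewrite E -[X in (X < _)%N]muln1 ltn_pmul2l //.
  by rewrite -(exp1n (logn (pdiv n) n)) ltn_exp2r // prime_gt1.
have H (c : R) k : [\/ c = 0, c = 1 | c = -1] -> 1 <= \sum_(i < (k * 2).+1) c ^+ i.
  elim: k => [|k IHk] hc; first by rewrite big_ord1.
  rewrite mulSn !add2n 2!big_ord_recr /= -addrA.
  have : 0 <= c ^+ (k * 2).+1 + c ^+ (k * 2).+2.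
    rewrite !exprS mulnC exprM; case: hc => ->; rewrite ?mul0r ?expr1n ?sqrrN ?expr1n; lra.
  have := IHk hc; lra.
exact: H.
Qed.

Lemma bernoulli_ineq (R : realType) (x : R) (n : nat) : -1 <= x -> 1 + n%:R * x <= (1 + x) ^+ n.
Proof.
move=> x1; elim: n => [|n IH]; first by rewrite mul0r addr0 expr0.
rewrite exprSr; apply: le_trans (ler_wpM2r _ IH); last by lra.
rewrite -natr1; have : 0 <= n%:R * x ^+ 2 by rewrite mulr_ge0 // sqr_ge0.
rewrite expr2; nra.
Qed.

(** * Geometric sums and the Lambert weights *)

Definition geom_sum (R : realType) (t : R) (d : nat) : R := \sum_(i < d) t ^+ i.

Lemma geom_sumE (R : realType) (t : R) (d : nat) : 1 - t ^+ d = (1 - t) * geom_sum t d.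
Proof.
rewrite /geom_sum; elim: d => [|d IH]; first by rewrite big_ord0 mulr0 subrr.
by rewrite big_ord_recr /= mulrDr -IH exprS; ring.
Qed.

Lemma geom_sum_ge (R : realType) (t : R) (d : nat) : 0 <= t <= 1 -> d%:R * t ^+ d <= geom_sum t d.
Proof.
move=> /andP[t0 t1]; rewrite /geom_sum mulr_natl -[X in _ *+ X]card_ord -sumr_const.
by apply: ler_sum => i _; apply: ler_wiXn2l => //; apply: ltnW.
Qed.

(** Pair t^i with t^(2d+1-i): their geometric mean is t^(d+1/2), which is at least t^(d+1). *)
Lemma geom_sum_double_ge (R : realType) (t : R) (d : nat) : 0 <= t <= 1 ->
  2 * d.+1%:R * t ^+ d.+1 <= geom_sum t d.+1 * (1 + t ^+ d.+1).
Proof.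
move=> /andP[t0 t1].
rewrite mulrDr mulr1 {2}/geom_sum (reindex_inj rev_ord_inj) /= mulr_suml -big_split /=.
have -> : 2 * d.+1%:R * t ^+ d.+1 = \sum_(i < d.+1) 2 * t ^+ d.+1 :> R.
  by rewrite sumr_const card_ord -[RHS]mulr_natr; ring.
apply: ler_sum => i _; have id := ltn_ord i; rewrite subSS -exprD.
have -> : (d - i + d.+1 = i + (d - i) * 2 + 1)%N by lia.
have -> : t ^+ d.+1 = t ^+ (i + (d - i) + 1) by congr (_ ^+ _); lia.
rewrite !exprD !expr1 exprM; set a := t ^+ i; set c := t ^+ (d - i).
have a0 : 0 <= a by rewrite exprn_ge0.
have c0 : 0 <= c by rewrite exprn_ge0.
have h : 2 * (c * t) <= 1 + c ^+ 2 * t.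
  apply: (@le_trans _ _ (1 + c ^+ 2 * t ^+ 2)).
    have := sqr_ge0 (1 - c * t); rewrite !expr2; lra.
  by rewrite lerD2l ler_wpM2l ?sqr_ge0 // expr2 ler_piMr.
have := ler_wpM2l a0 h; lra.
Qed.

Lemma geom_sum_mul_ge (R : realType) (t : R) (d : nat) : 0 <= t <= 1 ->
  (d * d.+1)%:R * t ^+ d <= geom_sum t d * geom_sum t d.+1.
Proof.
move=> t01; have /andP[t0 t1] := t01; elim: d => [|d IH].
  by rewrite mul0n mul0r /geom_sum big_ord0 mul0r.
have -> : geom_sum t d.+1 * geom_sum t d.+2 =
   t * (geom_sum t d * geom_sum t d.+1) + geom_sum t d.+1 * (1 + t ^+ d.+1).
  have -> : geom_sum t d.+2 = geom_sum t d.+1 + t ^+ d.+1 by rewrite /geom_sum big_ord_recr.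
  have : geom_sum t d.+1 = 1 + t * geom_sum t d.
    rewrite {1}/geom_sum big_ord_recl expr0; congr (_ + _).
    by rewrite /geom_sum mulr_sumr; apply: eq_bigr => i _; rewrite -exprS.
  by move=> e; rewrite mulrA; have -> : t * geom_sum t d = geom_sum t d.+1 - 1 by [rewrite e; ring]; ring.
have := ler_wpM2l t0 IH; have := geom_sum_double_ge d t01.
rewrite !natrM exprS -[d.+2%:R]natr1 -[d.+1%:R]natr1.
lra.
Qed.

(** [c d] is 1/d minus the Lambert weight (1-t) t^d / (1-t^d). Its monotonicity, equivalent to
    [geom_sum_mul_ge], lets Abel summation replace the Lambert series by the sum of chi(d)/d. *)
Lemma lambert_weight (R : realType) (t : R) (d : nat) : 0 < t < 1 -> (0 < d)%N ->
  let c d := d%:R^-1 - t ^+ d / geom_sum t d in 0 <= c d /\ c d.+1 <= c d.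
Proof.
move=> /andP[t0 t1] d0 c.
have t01 : 0 <= t <= 1 by rewrite !ltW.
have g0 e : (0 < e)%N -> 0 < geom_sum t e.
  move=> e0; apply: lt_le_trans (geom_sum_ge e t01).
  by rewrite mulr_gt0 ?ltr0n ?exprn_gt0.
have dR : 0 < d%:R :> R by rewrite ltr0n.
split.
  rewrite /c subr_ge0 ler_pdivrMr ?g0 // mulrC ler_pdivlMr // mulrC.
  exact: geom_sum_ge.
have e : geom_sum t d.+1 = 1 + t * geom_sum t d.
  rewrite {1}/geom_sum big_ord_recl expr0; congr (_ + _).
  by rewrite /geom_sum mulr_sumr; apply: eq_bigr => i _; rewrite -exprS.
have gd := g0 d d0; have gd1 := g0 d.+1 isT.
rewrite -subr_ge0 /c.
have -> : d%:R^-1 - t ^+ d / geom_sum t d - (d.+1%:R^-1 - t ^+ d.+1 / geom_sum t d.+1)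
  = ((d * d.+1)%:R)^-1 - t ^+ d / (geom_sum t d * geom_sum t d.+1).
  rewrite e natrM -[d.+1%:R]natr1 exprS; field.
  by rewrite !gt_eqF //= ?natr1 ?ltr0n // -e.
rewrite subr_ge0 ler_pdivrMr ?mulr_gt0 // mulrC ler_pdivlMr ?ltr0n ?muln_gt0 ?d0 //.
by rewrite mulrC geom_sum_mul_ge.
Qed.

Lemma sum_squares_le (R : realType) (u : nat -> R) (M N : nat) :
  (forall n, 0 <= u n) -> (M ^ 2 <= N)%N ->
  \sum_(1 <= s < M.+1) u (s ^ 2)%N <= \sum_(1 <= n < N.+1) u n.
Proof.
move=> u0; elim: M N => [|M IH] N MN; first by rewrite big_geq // sumr_ge0.
rewrite big_nat_recr //=.
rewrite [leRHS](big_cat_nat _ (n := (M.+1 ^ 2)%N)) ?expn_gt0 ?(leqW MN) //.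
apply: lerD; last by rewrite big_ltn ?ltnS // lerDl sumr_ge0.
have h : (0 < M.+1 ^ 2)%N by rewrite expn_gt0.
rewrite -(prednK h); apply: IH.
by rewrite -ltnS prednK // ltn_exp2r.
Qed.

(* Monsky's argument: if [\sum chi(d)/d = 0] then the Lambert series [\sum_n r(n) t^n],
   [r = 1 * chi], stays bounded as [t -> 1], although [r >= 0] and [r >= 1] on squares.
   Here [t = 1 - 1/y] with [y = 2 M^2], and the series is truncated at [N = 3 y^2]. *)
Lemma monsky (R : realType) (chi : nat -> R) (B K : R) :
  (forall m n, chi (m * n)%N = chi m * chi n) -> chi 1%N = 1 ->
  (forall n, [\/ chi n = 0, chi n = 1 | chi n = -1]) ->
  (forall j, `|\sum_(1 <= i < j) chi i| <= B) ->
  (forall N, (0 < N)%N -> `|\sum_(1 <= d < N) chi d / d%:R| <= K / N%:R) ->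
  False.
Proof.
move=> chiM chi1 chi3 hB hK.
have chile n : `|chi n| <= 1 by case: (chi3 n) => ->; rewrite ?normr0 ?normrN ?normr1.
have K0 : 0 <= K by have := hK 1%N isT; rewrite big_geq // normr0 divr1.
have B0 : 0 <= B by apply: le_trans (hB 0%N).
have key M : (0 < M)%N -> M%:R / 2 <= K + B + 3.
  (* With this [y], t^(s^2) >= 1 - s^2/y >= 1/2 for all [s <= M], so the squares alone give [M / 2].
     With this [N], t^N <= 2^(-3y), small enough to beat y^3. *)
  move=> M0; set y := (2 * M ^ 2)%N; set N := (3 * y ^ 2)%N.
  have y2 : (2 <= y)%N by rewrite /y -[X in (X <= _)%N]muln1 leq_mul2l expn_gt0 M0.
  have yR : 0 < y%:R :> R by rewrite ltr0n; lia.
  set dl : R := y%:R^-1; set t : R := 1 - dl.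
  have dl0 : 0 < dl by rewrite invr_gt0.
  have dl2 : dl <= 2^-1 by rewrite lef_pV2 ?posrE // ler_nat.
  have t0 : 0 < t by rewrite /t; lra.
  have t1 : t < 1 by rewrite /t; lra.
  have t01 : 0 < t < 1 by rewrite t0 t1.
  have omt : 1 - t = dl by rewrite /t; ring.
  have g0 e : (0 < e)%N -> 0 < geom_sum t e.
    move=> e0; apply: lt_le_trans (geom_sum_ge e _); last by rewrite !ltW.
    by rewrite mulr_gt0 ?ltr0n ?exprn_gt0.
  pose c d := d%:R^-1 - t ^+ d / geom_sum t d.
  have upper : \sum_(1 <= n < N.+1) divisor_sum chi n * t ^+ n <= K + B + 3.
    rewrite (eq_bigr (fun n => \sum_(1 <= d < n.+1 | (d %| n)%N) chi d * t ^+ n)); last first.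
      by move=> n _; rewrite /divisor_sum mulr_suml.
    rewrite (sum_divisors_swap N (fun d n => chi d * t ^+ n)).
    (* The finite geometric series in [m] is t^d / (1-t^d) = y (1/d - c d) minus a tail. The three
       resulting sums are bounded by [K] (decay hypothesis), by [B] (Abel summation, as c 1 = 1/y)
       and by 3 (smallness of t^N). *)
    rewrite (eq_big_nat _ _ (F2 := fun d => y%:R * (chi d / d%:R) - y%:R * (chi d * c d)
       - chi d * (t ^+ (d * (N %/ d).+1) / (1 - t ^+ d)))); last first.
      move=> d /andP[d0 _]; rewrite -mulr_sumr.
      have gd : geom_sum t d != 0 by rewrite gt_eqF // g0.
      have yn : y%:R != 0 :> R by rewrite gt_eqF.
      have h : \sum_(1 <= m < (N %/ d).+1) t ^+ (d * m) =
         (t ^+ d - t ^+ (d * (N %/ d).+1)) / (1 - t ^+ d).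
        apply: (mulIf (x := 1 - t ^+ d)).
          by rewrite geom_sumE omt mulf_neq0 // gt_eqF.
        rewrite divfK; last by rewrite geom_sumE omt mulf_neq0 // gt_eqF.
        elim: (N %/ d)%N => [|q IH]; first by rewrite big_geq // muln1 mul0r subrr.
        by rewrite big_nat_recr //= mulrDl IH [(d * q.+2)%N]mulnS exprD; ring.
      rewrite h /c geom_sumE omt /dl; field.
      by rewrite yn gd pnatr_eq0; lia.
    rewrite !sumrB -!mulr_sumr -addrA; have -> : K + B + 3 = K + (B + 3) by ring.
    apply: lerD.
      apply: le_trans (_ : y%:R * (K / N.+1%:R) <= _).
        by rewrite ler_pM2l //; apply: le_trans (hK N.+1 isT); apply: ler_norm.
      rewrite mulrCA ler_piMr // ler_pdivrMr ?ltr0n // mul1r ler_nat.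
      by rewrite /N; nia.
    apply: le_trans (ler_norm _) _; apply: le_trans (ler_normD _ _) _.
    rewrite !normrN; apply: lerD.
      have h : `|\sum_(1 <= i < N.+1) chi i * c i| <= B * c 1%N.
        apply: abel_bound => // i i0; first by have [] := lambert_weight t01 i0.
        by have [] := lambert_weight t01 i0.
      rewrite normrM ger0_norm ?(ltW yR) //.
      apply: le_trans (ler_wpM2l (ltW yR) h) _.
      rewrite /c /geom_sum big_ord1 expr1 expr0 invr1 mulr1 omt mulrCA divff ?mulr1 //.
      by rewrite gt_eqF.
    apply: le_trans (ler_norm_sum _ _ _) _.
    apply: le_trans (_ : \sum_(1 <= d < N.+1) y%:R * t ^+ N <= _).
      apply: ler_sum_nat => d /andP[d0 dN].
      rewrite normrM -[leRHS]mul1r ler_pM // ger0_norm; last first.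
        by rewrite divr_ge0 ?exprn_ge0 ?(ltW t0) // subr_ge0 exprn_ile1 // ltW.
      rewrite mulrC ler_pM ?exprn_ge0 ?(ltW t0) //.
      - by rewrite invr_ge0 subr_ge0 exprn_ile1 // ltW.
      - rewrite -[y%:R]invrK lef_pV2 ?posrE ?invr_gt0 //; last first.
          by rewrite geom_sumE mulr_gt0 ?g0 // omt.
        rewrite -/dl -omt lerD2l lerN2 -{2}[t]expr1 ler_wiXn2l // ltW //.
      - by rewrite ler_wiXn2l ?(ltW t0) ?(ltW t1) // mulnC ltnW // ltn_ceil.
    rewrite sumr_const_nat subn1 /=.
    (* By Bernoulli (1 + 1/y)^y >= 2, while t (1 + 1/y) = 1 - 1/y^2 <= 1. *)
    have ty : t ^+ y <= 2^-1.
      have h : 2 <= (1 + dl) ^+ y.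
        apply: le_trans (bernoulli_ineq y _); last by lra.
        by rewrite /dl divff ?gt_eqF.
      have h2 : t ^+ y * (1 + dl) ^+ y <= 1.
        rewrite -exprMn exprn_ile1 //; first by rewrite mulr_ge0 // ?(ltW t0) // addr_ge0 // ltW.
        have := sqr_ge0 dl; rewrite /t expr2; lra.
      have h3 : 0 <= t ^+ y by rewrite exprn_ge0 // ltW.
      have := ler_wpM2l h3 h; lra.
    have -> : (y%:R * t ^+ N) *+ N = 3 * (y%:R ^+ 3 * t ^+ N).
      by rewrite -mulr_natr /N natrM natrX; ring.
    rewrite -[leRHS]mulr1 ler_pM2l //.
    have -> : (N = y * (3 * y))%N by rewrite /N; ring.
    rewrite exprM; apply: (@le_trans _ _ (y%:R ^+ 3 * 2^-1 ^+ (3 * y))).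
      rewrite ler_wpM2l ?exprn_ge0 // lerXn2r ?nnegrE ?exprn_ge0 ?invr_ge0 // ltW //.
    rewrite exprVn ler_pdivrMr ?exprn_gt0 // mul1r mulnC exprM lerXn2r ?nnegrE ?exprn_ge0 //.
    by rewrite -natrX ler_nat ltnW // ltn_expl.
  have lower : M%:R / 2 <= \sum_(1 <= n < N.+1) divisor_sum chi n * t ^+ n.
    pose u n := if n is 0 then 0 else divisor_sum chi n * t ^+ n.
    rewrite (eq_big_nat _ _ (F2 := u)); last by case.
    have u0 n : 0 <= u n.
      by case: n => // n; rewrite mulr_ge0 ?divisor_sum_ge0 // exprn_ge0 // ltW.
    apply: le_trans (sum_squares_le (M := M) u0 _); last by rewrite /N /y; nia.
    have -> : M%:R / 2 = \sum_(1 <= s < M.+1) 2^-1 :> R.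
      by rewrite sumr_const_nat subn1 mulr_natl.
    apply: ler_sum_nat => s /andP[s0 sM].
    have s20 : (0 < s ^ 2)%N by rewrite expn_gt0 s0.
    have -> : u (s ^ 2)%N = divisor_sum chi (s ^ 2) * t ^+ (s ^ 2).
      by rewrite /u; case: (s ^ 2)%N s20.
    apply: (@le_trans _ _ (t ^+ (s ^ 2))); last first.
      by rewrite ler_peMl ?exprn_ge0 ?(ltW t0) // divisor_sum_sqr_ge1.
    apply: le_trans (bernoulli_ineq (s ^ 2) _); last by lra.
    rewrite mulrN lerBrDr -lerBrDl.
    have -> : 1 - 2^-1 = 2^-1 :> R by lra.
    rewrite ler_pdivrMr // mulrC ler_pdivlMr // -natrM ler_nat mulnC /y leq_mul2l /=.
    by rewrite leq_exp2r.
  exact: le_trans upper.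
have C0 : 0 <= 2 * (K + B + 3) by lra.
have := archi_boundP C0; set m := Num.bound _ => hm.
have m0 : (0 < m)%N by rewrite -(ltr0n R); apply: le_lt_trans hm.
have := key m m0; lra.
Qed.

(** * Functions on the units modulo [b] *)

(** The default value 1, taken when [n] is not prime to [b], is discarded by the guard in [ext]. *)
Definition unit_class (b n : nat) : {unit 'Z_b} := insubd (1%g : {unit 'Z_b}) (n%:R : 'Z_b).

Lemma val_unit_class (b n : nat) : (1 < b)%N -> coprime b n ->
  val (unit_class b n) = n%:R.
Proof. by move=> b1 cn; rewrite insubdK // -topredE /= unitZpE. Qed.

Lemma unit_classM (b m n : nat) : (1 < b)%N -> coprime b m -> coprime b n ->
  unit_class b (m * n) = (unit_class b m * unit_class b n)%g.
Proof.
move=> b1 cm cn; apply: val_inj.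
by rewrite /= !val_unit_class ?coprimeMr ?cm // natrM.
Qed.

Lemma unit_class1 (b : nat) : (1 < b)%N -> unit_class b 1 = 1%g.
Proof. by move=> b1; apply: val_inj; rewrite val_unit_class ?coprimen1. Qed.

Lemma unit_class_eq (b m n : nat) : (1 < b)%N -> coprime b m -> coprime b n ->
  (unit_class b m == unit_class b n) = (m == n %[mod b]).
Proof.
move=> b1 cm cn; rewrite -val_eqE /= !val_unit_class // -val_eqE /=.
by rewrite !val_Zp_nat.
Qed.

Lemma mul_unitC (b : nat) (g h : {unit 'Z_b}) : (g * h = h * g)%g.
Proof. by apply: val_inj; rewrite /= mulrC. Qed.

Definition ext (R : realType) (b : nat) (F : {unit 'Z_b} -> R) (n : nat) : R :=
  if coprime b n then F (unit_class b n) else 0.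

Lemma sum_ext (R : realType) (b : nat) (F : {unit 'Z_b} -> R) : (1 < b)%N ->
  \sum_(0 <= i < b) ext F i = \sum_g F g.
Proof.
move=> b1; rewrite /ext -[X in \sum_(0 <= i < X) _](Zp_cast b1) -big_mkcond big_mkord.
rewrite (reindex_onto (fun g : {unit 'Z_b} => val g)
  (fun i => insubd (1%g : {unit 'Z_b}) (i : 'Z_b))) /=; last first.
  by move=> i ci; rewrite insubdK // -topredE /= -(natr_Zp i) unitZpE.
apply: eq_big => [g|g _].
  rewrite (valKd (1%g : {unit 'Z_b}) g) eqxx andbT -(unitZpE _ b1) natr_Zp.
  exact: (valP g).
by rewrite /unit_class natr_Zp valKd.
Qed.

Lemma ext_period (R : realType) (b : nat) (F : {unit 'Z_b} -> R) (n : nat) : (1 < b)%N ->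
  ext F (n + b) = ext F n.
Proof.
move=> b1; rewrite /ext -coprime_modr modnDr coprime_modr.
case: ifP => // cn; congr F; apply/eqP.
by rewrite unit_class_eq ?modnDr // -coprime_modr modnDr coprime_modr.
Qed.

Lemma sum_ext_period (R : realType) (b : nat) (F : {unit 'Z_b} -> R) (n : nat) : (1 < b)%N ->
  \sum_g F g = 0 -> \sum_(0 <= i < n + b) ext F i = \sum_(0 <= i < n) ext F i.
Proof.
move=> b1 F0; elim: n => [|n IH]; first by rewrite add0n sum_ext // F0 big_geq.
by rewrite addSn big_nat_recr //= IH [RHS]big_nat_recr //= ext_period.
Qed.

(** It bounds the partial sums of [ext F] for [F] of mean zero and is invariant under shifts, so the
    error bounds are uniform over all shifts of [F]. *)
Definition l1norm (R : realType) (b : nat) (F : {unit 'Z_b} -> R) : R := \sum_g `|F g|.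

Lemma l1norm_ge0 (R : realType) (b : nat) (F : {unit 'Z_b} -> R) : 0 <= l1norm F.
Proof. by apply: sumr_ge0. Qed.

Lemma l1norm_shift (R : realType) (b : nat) (F : {unit 'Z_b} -> R) (h : {unit 'Z_b}) :
  l1norm (fun g => F (h * g)%g) = l1norm F.
Proof. by rewrite /l1norm [RHS](reindex_inj (mulgI h)). Qed.

Lemma norm_sum_ext_le (R : realType) (b : nat) (F : {unit 'Z_b} -> R) (n : nat) : (1 < b)%N ->
  \sum_g F g = 0 -> `|\sum_(0 <= i < n) ext F i| <= l1norm F.
Proof.
move=> b1 F0; elim/ltn_ind: n => n IH.
have [bn|nb] := leqP b n.
  by rewrite -(subnK bn) sum_ext_period //; apply: IH; lia.
rewrite /l1norm -(sum_ext (fun g => `|F g|)) // (le_trans (ler_norm_sum _ _ _)) //.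
rewrite [leRHS](big_cat_nat _ (n := n)) ?(ltnW nb) //=.
rewrite (eq_bigr (ext (fun g => `|F g|))) ?lerDl; last first.
  by move=> i _; rewrite /ext; case: ifP; rewrite ?normr0.
by apply: sumr_ge0 => i _; rewrite /ext; case: ifP.
Qed.

Lemma norm_sum_ext_window_le (R : realType) (b : nat) (F : {unit 'Z_b} -> R) (m n : nat) :
  (1 < b)%N -> \sum_g F g = 0 -> `|\sum_(m <= i < n) ext F i| <= 2 * l1norm F.
Proof.
move=> b1 F0; have [mn|nm] := leqP m n; last first.
  by rewrite big_geq ?(ltnW nm) // normr0 mulr_ge0 ?l1norm_ge0.
have -> : \sum_(m <= i < n) ext F i = \sum_(0 <= i < n) ext F i - \sum_(0 <= i < m) ext F i.
  by rewrite [X in _ = X - _](big_cat_nat _ (n := m)) //= addrAC subrr add0r.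
have := norm_sum_ext_le n b1 F0; have := norm_sum_ext_le m b1 F0.
have := ler_normB (\sum_(0 <= i < n) ext F i) (\sum_(0 <= i < m) ext F i).
lra.
Qed.

(** * Convergence of harmonic sums of functions of mean zero *)

Definition harmonic_sum (R : realType) (b : nat) (F : {unit 'Z_b} -> R) (N : nat) : R :=
  \sum_(1 <= m < N) ext F m / m%:R.

Lemma abel_sum_ext_le (R : realType) (b : nat) (F : {unit 'Z_b} -> R) (w : nat -> R) (m n : nat) :
  (1 < b)%N -> \sum_g F g = 0 -> (0 < m)%N -> (m <= n)%N ->
  (forall i, (0 < i)%N -> w i.+1 <= w i) -> (forall i, (0 < i)%N -> 0 <= w i) ->
  `|\sum_(m <= i < n) ext F i * w i| <= 2 * l1norm F * w m.
Proof.
move=> b1 F0 m0 mn wd w0; apply: abel_bound => //.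
- by move=> j; apply: norm_sum_ext_window_le.
- by move=> i mi; apply: wd; lia.
- by move=> i mi; apply: w0; lia.
Qed.

Lemma harmonic_sum_cauchy (R : realType) (b : nat) (F : {unit 'Z_b} -> R) (M N : nat) :
  (1 < b)%N -> \sum_g F g = 0 -> (0 < M)%N -> (M <= N)%N ->
  `|harmonic_sum F N - harmonic_sum F M| <= 2 * l1norm F / M%:R.
Proof.
move=> b1 F0 M0 MN; rewrite /harmonic_sum (big_cat_nat _ (n := M)) //= addrAC subrr add0r.
apply: (abel_sum_ext_le (w := fun i => i%:R^-1)) => // i i0; last by rewrite invr_ge0.
by rewrite lef_pV2 ?posrE ?ltr0n // ler_nat.
Qed.

(* The limit of [harmonic_sum F] for [F] of mean zero, as the supremum of its lower error bounds. *)
Definition harmonic_limit (R : realType) (b : nat) (F : {unit 'Z_b} -> R) : R :=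
  sup [set x | exists2 N, (0 < N)%N & x = harmonic_sum F N - 2 * l1norm F / N%:R]%classic.

Lemma harmonic_limitP (R : realType) (b : nat) (F : {unit 'Z_b} -> R) (M : nat) :
  (1 < b)%N -> \sum_g F g = 0 -> (0 < M)%N ->
  `|harmonic_sum F M - harmonic_limit F| <= 2 * l1norm F / M%:R.
Proof.
move=> b1 F0 M0; rewrite /harmonic_limit; set A := [set x | _]%classic.
have ub N' : (0 < N')%N -> ubound A (harmonic_sum F N' + 2 * l1norm F / N'%:R).
  move=> N'0 _ [N N0 ->].
  have pos n : 0 <= 2 * l1norm F / n%:R by rewrite !mulr_ge0 ?l1norm_ge0 // invr_ge0.
  have [h|h] := leqP N N'.
    have := harmonic_sum_cauchy b1 F0 N0 h; rewrite ler_norml => /andP[]; have := pos N'; lra.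
  have := harmonic_sum_cauchy b1 F0 N'0 (ltnW h); rewrite ler_norml => /andP[]; have := pos N; lra.
rewrite ler_norml; apply/andP; split.
  have : sup A <= harmonic_sum F M + 2 * l1norm F / M%:R.
    apply: ge_sup; last exact: ub.
    by exists (harmonic_sum F 1 - 2 * l1norm F / 1%:R); exists 1%N.
  lra.
have : harmonic_sum F M - 2 * l1norm F / M%:R <= sup A.
  apply: ub_le_sup; last by exists M.
  by exists (harmonic_sum F M + 2 * l1norm F / M%:R); apply: ub.
lra.
Qed.

(** The sum of F(hm)/m over [m] prime to [b]; for a nontrivial real character chi it is L(1, chi)
    chi(h). *)
Definition Lop (R : realType) (b : nat) (F : {unit 'Z_b} -> R) (h : {unit 'Z_b}) : R :=
  harmonic_limit (fun g => F (h * g)%g).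

Lemma sum_shift0 (R : realType) (b : nat) (F : {unit 'Z_b} -> R) (h : {unit 'Z_b}) :
  \sum_g F g = 0 -> \sum_g F (h * g)%g = 0.
Proof. by move=> F0; rewrite -[RHS]F0 [RHS](reindex_inj (mulgI h)). Qed.

(** * Mertens-type estimates for functions of mean zero *)

Lemma sum_ext_divisors (R : realType) (b : nat) (F : {unit 'Z_b} -> R) (a : nat -> R) (x : nat) :
  (1 < b)%N ->
  \sum_(1 <= n < x.+1) ext F n / n%:R * \sum_(1 <= d < n.+1 | (d %| n)%N) a d =
  \sum_(1 <= d < x.+1) a d / d%:R * ext (fun h => harmonic_sum (fun g => F (h * g)%g) (x %/ d).+1) d.
Proof.
move=> b1.
rewrite (eq_bigr (fun n => \sum_(1 <= d < n.+1 | (d %| n)%N) a d * (ext F n / n%:R))); last first.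
  by move=> n _; rewrite mulr_sumr; apply: eq_bigr => d _; rewrite mulrC.
rewrite (sum_divisors_swap x (fun d n => a d * (ext F n / n%:R))).
apply: eq_bigr => d _; rewrite {2}/ext; case: ifP => cd; last first.
  rewrite mulr0 big1 // => m _.
  by rewrite /ext coprimeMr cd mul0r mulr0.
rewrite /harmonic_sum mulr_sumr; apply: eq_bigr => m _.
rewrite /ext coprimeMr cd /=; case: ifP => cm; last by rewrite !mul0r !mulr0.
by rewrite unit_classM // natrM invfM; ring.
Qed.

(** Cutting the inner sum at x/d costs at most [2 * l1norm F] times d/x, and this [d] cancels the
    weight 1/d of the outer sum. It is applied with a = Lambda and with a(d) = moebius(d)
    ln(x/d). *)
Lemma sum_ext_divisors_approx (R : realType) (b : nat) (F : {unit 'Z_b} -> R) (a : nat -> R) (x : nat) :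
  (1 < b)%N -> \sum_g F g = 0 -> (0 < x)%N ->
  `|\sum_(1 <= n < x.+1) ext F n / n%:R * (\sum_(1 <= d < n.+1 | (d %| n)%N) a d)
    - \sum_(1 <= d < x.+1) a d / d%:R * ext (Lop F) d|
   <= 2 * l1norm F / x%:R * \sum_(1 <= d < x.+1) `|a d|.
Proof.
move=> b1 F0 x0; rewrite sum_ext_divisors // -sumrB (le_trans (ler_norm_sum _ _ _)) //.
have xR : 0 < x%:R :> R by rewrite ltr0n.
rewrite mulr_sumr; apply: ler_sum_nat => d /andP[d0 dx].
have dR : 0 < d%:R :> R by rewrite ltr0n.
have K0 : 0 <= 2 * l1norm F by rewrite mulr_ge0 // l1norm_ge0.
rewrite -mulrBr /ext; case: ifP => cd; last first.
  by rewrite subrr mulr0 normr0 mulr_ge0 // divr_ge0 // ltW.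
rewrite !normrM [`|d%:R^-1|]ger0_norm ?invr_ge0 ?(ltW dR) //.
rewrite -mulrA [leRHS]mulrC; apply: ler_wpM2l => //.
have := harmonic_limitP b1 (sum_shift0 (unit_class b d) F0) (ltn0Sn (x %/ d)).
rewrite l1norm_shift -/(Lop F (unit_class b d)) => h.
rewrite ler_pdivrMl // (le_trans h) //.
rewrite mulrCA ler_wpM2l // ler_pdivlMr // ler_pdivrMl ?ltr0n // -natrM ler_nat.
by rewrite ltnW // ltn_ceil.
Qed.

Lemma sum_von_mangoldt_Lop (R : realType) (b : nat) (F : {unit 'Z_b} -> R) :
  (1 < b)%N -> \sum_g F g = 0 -> exists C : R, forall x, (0 < x)%N ->
  `|\sum_(1 <= d < x.+1) von_mangoldt R d / d%:R * ext (Lop F) d| <= C.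
Proof.
move=> b1 F0; exists (4 * l1norm F + 12 * l1norm F) => x x0.
have xR : 0 < x%:R :> R by rewrite ltr0n.
have := sum_ext_divisors_approx (von_mangoldt R) b1 F0 x0.
(* (ln n)/n is not monotone from [n = 1] on, but (ln n + 1)/n and 1/n both decrease, so Abel
   summation applies to each. *)
rewrite (eq_big_nat _ _ (F2 := fun n => ext F n * ((ln n%:R + 1) / n%:R) - ext F n * n%:R^-1)); last first.
  by move=> n /andP[n0 _]; rewrite sum_von_mangoldt_divisors //; ring.
rewrite sumrB; set S := \sum_(_ <= _ < _) _ / _ * _.
have h1 : `|\sum_(1 <= i < x.+1) ext F i * ((ln i%:R + 1) / i%:R)| <= 2 * l1norm F.
  apply: le_trans (abel_sum_ext_le (w := fun i => (ln i%:R + 1) / i%:R) _ _ _ _ _ _) _ => //.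
  - move=> i i0; rewrite ler_pdivrMr ?ltr0n // mulrAC ler_pdivlMr ?ltr0n //.
    have := ln_succ_le R i0; have := ln_nat_ge0 R i.
    by set L := ln i.+1%:R; rewrite -[i.+1%:R]natr1; lra.
  - by move=> i i0; rewrite divr_ge0 // addr_ge0 // ln_nat_ge0.
  - by rewrite ln1 add0r divr1 mulr1.
have h2 : `|\sum_(1 <= i < x.+1) ext F i * i%:R^-1| <= 2 * l1norm F.
  apply: le_trans (abel_sum_ext_le (w := fun i => i%:R^-1) _ _ _ _ _ _) _ => //.
  - by move=> i i0; rewrite lef_pV2 ?posrE ?ltr0n // ler_nat.
  - by move=> i i0; rewrite invr_ge0.
  - by rewrite invr1 mulr1.
have h3 : 2 * l1norm F / x%:R * (\sum_(1 <= d < x.+1) `|von_mangoldt R d|) <= 12 * l1norm F.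
  rewrite (eq_bigr (von_mangoldt R)); last by move=> d _; rewrite ger0_norm // von_mangoldt_ge0.
  have -> : 12 * l1norm F = 2 * l1norm F / x%:R * (6 * x%:R) by field; rewrite gt_eqF.
  by rewrite ler_wpM2l ?chebyshev_psi_le // divr_ge0 ?mulr_ge0 ?l1norm_ge0.
move: h1 h2; rewrite !ler_norml => /andP[? ?] /andP[? ?] /andP[? ?].
apply/andP; split; lra.
Qed.

(** With a(d) = moebius(d) ln(x/d) the main term contains [Lop F] and vanishes; [sum_moebius_ln]
    evaluates the other side. The error stays bounded because the sum of ln(x/d) is x ln x - ln x!
    <= x. *)
Lemma sum_von_mangoldt_ker (R : realType) (b : nat) (F : {unit 'Z_b} -> R) :
  (1 < b)%N -> \sum_g F g = 0 -> (forall h, Lop F h = 0) -> exists C : R, forall x, (0 < x)%N ->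
  `|\sum_(1 <= d < x.+1) von_mangoldt R d / d%:R * ext F d + F 1%g * ln x%:R| <= C.
Proof.
move=> b1 F0 L0; exists (2 * l1norm F) => x x0.
have xR : 0 < x%:R :> R by rewrite ltr0n.
have := sum_ext_divisors_approx (fun d => moebius R d * (ln x%:R - ln d%:R)) b1 F0 x0.
rewrite [X in `|_ - X|]big1 ?subr0; last first.
  by move=> d _; rewrite /ext L0 if_same mulr0.
rewrite (eq_big_nat _ _ (F2 := fun n => (if n == 1%N then F 1%g * ln x%:R else 0)
    + von_mangoldt R n / n%:R * ext F n)); last first.
  move=> n /andP[n0 _]; rewrite sum_moebius_ln //.
  have [->|_] := eqVneq n 1%N; last by rewrite mul0r !add0r; ring.
  by rewrite /ext coprimen1 unit_class1 // invr1 mul1r; ring.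
rewrite big_split /= big_ltn // eqxx big1_seq ?addr0; last first.
  by move=> n; rewrite mem_index_iota => /andP[_ /andP[n2 _]]; case: eqP => // n1; lia.
rewrite [X in `|X|]addrC => /le_trans; apply.
rewrite (eq_big_nat _ _ (F2 := fun d => `|moebius R d| * (ln x%:R - ln d%:R))); last first.
  move=> d /andP[d0 dx]; rewrite normrM [X in _ * X]ger0_norm // subr_ge0.
  by rewrite ler_ln ?posrE ?ltr0n // ler_nat -ltnS.
apply: (@le_trans _ _ (2 * l1norm F / x%:R * (\sum_(1 <= d < x.+1) (ln x%:R - ln d%:R)))).
  rewrite ler_wpM2l ?divr_ge0 ?mulr_ge0 ?l1norm_ge0 //.
  apply: ler_sum_nat => d /andP[d0 dx]; rewrite ler_piMl ?norm_moebius_le // subr_ge0.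
  by rewrite ler_ln ?posrE ?ltr0n // ler_nat -ltnS.
rewrite sumrB sumr_const_nat subn1 /= -ln_fact_sum -[ln _ *+ x]mulr_natl.
rewrite -mulrA ler_piMr ?mulr_ge0 ?l1norm_ge0 // mulrC ler_pdivrMr // mul1r.
have := ln_fact_ge R x0; lra.
Qed.

Definition class_mass (R : realType) (b x : nat) (g : {unit 'Z_b}) : R :=
  \sum_(1 <= n < x.+1) von_mangoldt R n / n%:R * ext (fun h => (h == g)%:R) n.

Lemma sum_class_mass (R : realType) (b x : nat) (H : {unit 'Z_b} -> R) :
  \sum_g class_mass R x g * H g = \sum_(1 <= n < x.+1) von_mangoldt R n / n%:R * ext H n.
Proof.
rewrite /class_mass; under eq_bigr do rewrite mulr_suml.
rewrite exchange_big /=; apply: eq_bigr => n _.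
under eq_bigr do rewrite -mulrA; rewrite -mulr_sumr; congr (_ * _).
rewrite /ext; case: ifP => cn; last by rewrite big1 // => g _; rewrite mul0r.
rewrite (bigD1 (unit_class b n)) //= eqxx mul1r big1 ?addr0 // => g.
by rewrite eq_sym => /negbTE ->; rewrite mul0r.
Qed.

Lemma class_mass_ge0 (R : realType) (b x : nat) (g : {unit 'Z_b}) : 0 <= class_mass R x g.
Proof.
apply: sumr_ge0 => n _; rewrite !mulr_ge0 ?von_mangoldt_ge0 ?invr_ge0 //.
by rewrite /ext; case: ifP.
Qed.

(** * Dirichlet's theorem *)

(** Each coordinate converges along the same ultrafilter finer than the cofinite one, which replaces
    successive extraction of subsequences. *)
Lemma bounded_cluster_point (R : realType) (I : finType) (q : nat -> I -> R) (A : R) :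
  (forall x i, 0 <= q x i <= A) ->
  exists mu : I -> R, forall (eps : R) N, 0 < eps ->
    exists2 x, (N <= x)%N & forall i, `|q x i - mu i| < eps.
Proof.
move=> qA; have [U [UU sU]] := ultraFilterLemma (eventually_filter).
have cU i : exists p : R, forall eps : R, 0 < eps -> U [set x | `|q x i - p| < eps]%classic.
  have FA : (q^~ i @ U)%classic `[0, A]%classic.
    rewrite /fmap /=; apply: filterS (filterT : U setT) => x _ /=.
    by rewrite in_itv /= qA.
  have [p [_ clp]] := segment_compact (fmap_proper_filter (q^~ i) (@ultra_proper _ _ UU)) FA.
  exists p => eps e0.
  have [//|nU] := in_ultra_setVsetC [set x | `|q x i - p| < eps]%classic UU.
  have [y [/= h1 h2]] := clp (~` [set y | `|y - p| < eps])%classic (ball p eps) nU (nbhsx_ballx p eps e0).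
  by exfalso; apply: h1; rewrite distrC.
have [mu hmu] := choice cU; exists mu => eps N e0.
have UN : U [set x | (N <= x)%N]%classic by apply: sU; exists N.
have Uall : U [set x | forall i, `|q x i - mu i| < eps]%classic.
  by apply: filter_forall => i; apply: hmu.
have [x [h1 h2]] := filter_ex (filterI UN Uall).
by exists x.
Qed.

Lemma log_cluster_point (R : realType) (I : finType) (m : nat -> I -> R) (C : R) :
  (forall x i, 0 <= m x i) ->
  (forall x, (0 < x)%N -> `|\sum_i m x i - ln x%:R| <= C) ->
  exists mu : I -> R, (forall i, 0 <= mu i) /\
   forall (H : I -> R) c, (exists C' : R, forall x, (0 < x)%N ->
     `|\sum_i m x i * H i - c * ln x%:R| <= C') -> \sum_i mu i * H i = c.
Proof.
move=> m0 mC.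
have ln2 : 0 < ln 2 :> R by apply: ln_gt0; lra.
have C0 : 0 <= C by apply: le_trans (mC 1%N isT).
(* The shift by 2 keeps the denominator at least [ln 2]. *)
pose q x i := m x.+2 i / ln x.+2%:R.
have lx x : ln 2 <= ln x.+2%:R :> R by rewrite ler_ln ?posrE ?ltr0n // ler_nat.
have qA x i : 0 <= q x i <= 1 + C / ln 2.
  rewrite divr_ge0 ?ln_nat_ge0 //= ler_pdivrMr; last exact: lt_le_trans (lx x).
  have h : m x.+2 i <= \sum_i m x.+2 i by rewrite (bigD1 i) //= lerDl sumr_ge0.
  have := mC x.+2 isT; rewrite ler_norml => /andP[_ h2].
  have : C <= C / ln 2 * ln x.+2%:R.
    by rewrite -[leLHS](divfK (x := ln 2)) ?gt_eqF // ler_wpM2l // divr_ge0 // ltW.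
  lra.
have [mu hmu] := bounded_cluster_point qA.
exists mu; split.
  move=> i; rewrite leNgt; apply/negP => mi.
  have [x _ /(_ i)] := hmu (- mu i) 0%N ltac:(lra).
  have /andP[h _] := qA x i.
  by rewrite ltr_norml => /andP[_]; lra.
move=> H c [C' hC'].
have C'0 : 0 <= C' by apply: le_trans (hC' 1%N isT).
pose S := \sum_i `|H i|.
have S0 : 0 <= S by apply: sumr_ge0.
suff key (eps : R) : 0 < eps -> `|\sum_i mu i * H i - c| <= eps * (S + 1).
  apply/eqP; rewrite -subr_eq0 -normr_le0; apply/ler_addgt0Pr => e e0; rewrite add0r.
  have s1 : 0 < S + 1 by lra.
  have := key (e / (S + 1)) (divr_gt0 e0 s1).
  by rewrite divfK // gt_eqF.
move=> e0.
have [N hN] : exists N : nat, C' / eps <= ln N.+2%:R.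
  exists (Num.bound (expR (C' / eps))).
  have h := archi_boundP (expR_ge0 (C' / eps)).
  rewrite -[leLHS]expRK ler_ln ?posrE ?expR_gt0 ?ltr0n //.
  by apply/ltW/(lt_le_trans h); rewrite ler_nat -addn2 leq_addr.
have [x Nx hx] := hmu eps N e0.
have l0 : 0 < ln x.+2%:R :> R by apply: lt_le_trans (lx x).
have lN : C' / eps <= ln x.+2%:R.
  by apply: le_trans hN _; rewrite ler_ln ?posrE ?ltr0n // ler_nat !ltnS.
have h1 : `|\sum_i q x i * H i - c| <= eps.
  have -> : \sum_i q x i * H i - c = (\sum_i m x.+2 i * H i - c * ln x.+2%:R) / ln x.+2%:R.
    rewrite mulrBl mulfK ?gt_eqF // mulr_suml; congr (_ - _).
    by apply: eq_bigr => i _; rewrite /q mulrAC.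
  rewrite normrM normfV (gtr0_norm l0) ler_pdivrMr //.
  apply: le_trans (hC' x.+2 isT) _; rewrite mulrC -ler_pdivrMr //.
have h2 : `|\sum_i mu i * H i - \sum_i q x i * H i| <= eps * S.
  rewrite -sumrB (le_trans (ler_norm_sum _ _ _)) // /S mulr_sumr.
  apply: ler_sum => i _; rewrite -mulrBl normrM ler_wpM2r // distrC ltW //.
have := ler_normD (\sum_i mu i * H i - \sum_i q x i * H i) (\sum_i q x i * H i - c).
rewrite addrA subrK; lra.
Qed.

(* A convolution idempotent with values in [[-1, 1]] taking the value [1] is a real character:
   equality must hold throughout in the averages defining [c a] and [c k]. *)
Lemma real_character (R : realType) (gT : finGroupType) (c : gT -> R) (a : gT) :
  (forall g, `|c g| <= 1) ->
  (forall k, \sum_g c g * c (k * g^-1)%g = #|gT|%:R * c k) -> c a = 1 ->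
  [/\ c 1%g = 1, forall g, c g = 1 \/ c g = -1 & forall g h, c (h * g)%g = c h * c g].
Proof.
move=> c1 conv ca.
have ext1 (F : gT -> R) : (forall g, F g <= 1) -> \sum_g F g = #|gT|%:R -> forall g, F g = 1.
  move=> F1 sF g; have h : \sum_g (1 - F g) = 0.
    by rewrite sumrB sF sumr_const subrr.
  have F1' i : true -> 0 <= 1 - F i by rewrite subr_ge0 F1.
  have := psumr_eq0P F1' h (i := g) isT; lra.
have prod_le g h : c g * c h <= 1.
  apply: le_trans (ler_norm _) _; rewrite normrM -[leRHS]mulr1 ler_pM //.
have hg g : c g * c (a * g^-1)%g = 1.
  by apply: (ext1 (fun g => c g * c (a * g^-1)%g)) => [g'|]; rewrite ?prod_le // conv ca mulr1.
have pm g : c g = 1 \/ c g = -1.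
  have h := hg g; have := c1 g; have := c1 (a * g^-1)%g.
  rewrite !ler_norml => /andP[? ?] /andP[? ?].
  have [g0|g0] := leP 0 (c g); [left|right]; nra.
have c11 : c 1%g = 1 by have := hg a; rewrite ca mul1r mulgV.
split=> // g h.
have sq k : c k * c k = 1 by case: (pm k) => ->; ring.
(* As [c (h * g)] is 1 or -1, the terms of its own convolution formula, multiplied by it, are at
   most 1 and average to 1; hence each equals 1. *)
have : c (h * g)%g * (c g * c (h * g * g^-1)%g) = 1.
  apply: (ext1 (fun g' => c (h * g)%g * (c g' * c (h * g * g'^-1)%g))) => [g'|].
    have := prod_le g' (h * g * g'^-1)%g; case: (pm (h * g)%g) => ->; first by rewrite mul1r.
    move=> _; case: (pm g') => ->; case: (pm (h * g * g'^-1)%g) => ->; lra.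
  by rewrite -mulr_sumr conv mulrCA sq mulr1.
rewrite mulgK => e.
have : c (h * g)%g * c (h * g)%g * (c g * c h) = c (h * g)%g by rewrite -mulrA e mulr1.
by rewrite sq mul1r mulrC.
Qed.

Lemma harmonic_limit_unique (R : realType) (b : nat) (F : {unit 'Z_b} -> R) (l C : R) :
  (1 < b)%N -> \sum_g F g = 0 ->
  (forall M, (0 < M)%N -> `|harmonic_sum F M - l| <= C / M%:R) -> harmonic_limit F = l.
Proof.
move=> b1 F0 hl; apply/eqP; rewrite -subr_eq0 -normr_le0; apply/ler_addgt0Pr => e e0.
rewrite add0r; set D := 2 * l1norm F + C.
have D0 : 0 <= D.
  rewrite addr_ge0 ?mulr_ge0 ?l1norm_ge0 //.
  by have := hl 1%N isT; rewrite divr1; apply: le_trans.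
have h := archi_boundP (divr_ge0 D0 (ltW e0)); set M := Num.bound _ in h.
have M0 : (0 < M)%N by rewrite -(ltr0n R); apply: le_lt_trans h; rewrite divr_ge0 // ltW.
have MR : 0 < M%:R :> R by rewrite ltr0n.
have h1 := hl M M0; have h2 := harmonic_limitP b1 F0 M0.
have DM : D / M%:R <= e by rewrite ler_pdivrMr // mulrC -ler_pdivrMr // ltW.
have := ler_normD (harmonic_limit F - harmonic_sum F M) (harmonic_sum F M - l).
rewrite addrA subrK [X in _ <= X + _]distrC => h3.
by apply: le_trans h3 _; apply: le_trans DM; rewrite /D mulrDl lerD.
Qed.

Lemma harmonic_limit_sum (R : realType) (b : nat) (I : finType) (a : I -> R)
    (F : I -> {unit 'Z_b} -> R) :
  (1 < b)%N -> (forall i, \sum_g F i g = 0) ->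
  harmonic_limit (fun g => \sum_i a i * F i g) = \sum_i a i * harmonic_limit (F i).
Proof.
move=> b1 F0; apply: (harmonic_limit_unique (C := \sum_i `|a i| * (2 * l1norm (F i)))) => //.
  by rewrite exchange_big big1 // => i _; rewrite -mulr_sumr F0 mulr0.
move=> M M0.
have -> : harmonic_sum (fun g => \sum_i a i * F i g) M = \sum_i a i * harmonic_sum (F i) M.
  rewrite /harmonic_sum; under [RHS]eq_bigr do rewrite mulr_sumr.
  rewrite [RHS]exchange_big; apply: eq_bigr => m _ /=.
  rewrite /ext; case: ifP => _; last by rewrite mul0r big1 // => i _; rewrite ?mul0r ?mulr0 ?mul0r ?mulr0.
  by rewrite mulr_suml; apply: eq_bigr => i _; rewrite mulrA.
rewrite -sumrB (le_trans (ler_norm_sum _ _ _)) // mulr_suml; apply: ler_sum => i _.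
by rewrite -mulrBr normrM -mulrA ler_wpM2l // harmonic_limitP.
Qed.

(** The classes miss only integers not prime to [b]: proper prime powers cost at most 8, and the
    primes dividing [b] at most psi(b). *)
Lemma sum_class_mass_ln (R : realType) (b : nat) : (1 < b)%N ->
  exists C : R, forall x, (0 < x)%N -> `|\sum_g class_mass R x (g : {unit 'Z_b}) - ln x%:R| <= C.
Proof.
move=> b1; exists (6 + (8 + chebyshev_psi R b)) => x x0.
have -> : \sum_g class_mass R x (g : {unit 'Z_b}) = 
   \sum_(1 <= d < x.+1) von_mangoldt R d / d%:R
   - \sum_(1 <= d < x.+1 | ~~ coprime b d) von_mangoldt R d / d%:R.
  rewrite -[LHS](eq_bigr _ (fun g _ => mulr1 (class_mass R x g))).
  rewrite (sum_class_mass x (fun=> 1)) [X in X - _](bigID (coprime b)) /= addrK [RHS]big_mkcond.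
  by apply: eq_bigr => d _; rewrite /ext; case: ifP; rewrite ?mulr1 ?mulr0.
have vd d : 0 <= von_mangoldt R d / d%:R by rewrite divr_ge0 // von_mangoldt_ge0.
have h0 : 0 <= \sum_(1 <= d < x.+1 | ~~ coprime b d) von_mangoldt R d / d%:R by apply: sumr_ge0.
have h1 : \sum_(1 <= d < x.+1 | ~~ coprime b d) von_mangoldt R d / d%:R <= 8 + chebyshev_psi R b.
  rewrite (bigID (fun d => ~~ prime d)) /=; apply: lerD.
    apply: le_trans (sum_nonprime_von_mangoldt_le R x.+1).
    by rewrite big_mkcondl; apply: ler_sum => d _; case: ifP.
  apply: (@le_trans _ _ (\sum_(1 <= d < (maxn x b).+1 | (d <= b)%N) von_mangoldt R d)).
    rewrite [leRHS](big_cat_nat _ (n := x.+1)) ?ltnS ?leq_maxl //=.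
    rewrite -[leLHS]addr0; apply: lerD; last by apply: sumr_ge0 => d _; apply: von_mangoldt_ge0.
    rewrite big_mkcond [leRHS]big_mkcond; apply: ler_sum_nat => d /andP[d0 _].
    case: ifP => [|_]; last by case: ifP => // _; apply: von_mangoldt_ge0.
    rewrite negbK => /andP[nc pd].
    rewrite coprime_sym prime_coprime // negbK in nc.
    rewrite dvdn_leq ?(ltnW b1) // ler_pdivrMr ?ltr0n // ler_peMr ?von_mangoldt_ge0 //.
    by rewrite ler1n.
  rewrite (big_cat_nat _ (n := b.+1)) ?ltnS ?leq_maxr //= [X in _ + X]big1_seq ?addr0; last first.
    by move=> d; rewrite mem_index_iota => /andP[db /andP[bd _]]; lia.
  rewrite big_mkcond; apply: ler_sum => d _; case: ifP => // _; exact: von_mangoldt_ge0.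
have := mertens R x0; rewrite !ler_norml => /andP[? ?].
apply/andP; split; lra.
Qed.

(** Without primes in the class, only proper prime powers carry mass. *)
Lemma class_mass_le (R : realType) (b x : nat) (a : nat) : (1 < b)%N -> coprime b a ->
  (forall p, prime p -> p != a %[mod b]) -> class_mass R x (unit_class b a) <= 8.
Proof.
move=> b1 ca np; apply: le_trans (sum_nonprime_von_mangoldt_le R x.+1).
rewrite [leRHS]big_mkcond; apply: ler_sum => n _.
have vd : 0 <= von_mangoldt R n / n%:R by rewrite divr_ge0 // von_mangoldt_ge0.
rewrite /ext; case: ifP => cn; last by rewrite mulr0; case: ifP.
rewrite unit_class_eq //; case: ifP => pn.
  by case: eqP; rewrite ?mulr1 ?mulr0.
by rewrite (negbTE (np n _)) ?mulr0 // -[prime n]negbK pn.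
Qed.

(* If the class of [a] has no primes, a limit [mu] of [class_mass x g / ln x] vanishes at [a]. It
   satisfies [mu * mu + mu = 2 / #|G|], so [c = 1 - #|G| mu] is an idempotent for the averaged
   convolution, equal to [1] at [a]. Hence it is a real character killed by [Lop].
   [R] is only the field in which the analysis is carried out. *)
Theorem dirichlet (b a : nat) (R : realType) : (1 < b)%N -> coprime b a ->
  exists2 p, prime p & p = a %[mod b].
Proof.
move=> b1 ca; apply: contrapT => noP.
have np p : prime p -> p != a %[mod b].
  by move=> pp; apply/eqP => e; apply: noP; exists p.
have [C hC] := sum_class_mass_ln R b1.
have [mu [mu0 muH]] := log_cluster_point (fun x g => class_mass_ge0 R x g) hC.
have mu1 : \sum_g mu g = 1.
  rewrite -(muH (fun=> 1) 1); first by apply: eq_bigr => g _; rewrite mulr1.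
  exists C => x x0; rewrite mul1r (eq_bigr (class_mass R x)); first exact: hC.
  by move=> g _; rewrite mulr1.
have mua : mu (unit_class b a) = 0.
  rewrite -(muH (fun g => (g == unit_class b a)%:R) 0).
    by rewrite (bigD1 (unit_class b a)) //= eqxx mulr1 big1 ?addr0 // => g /negbTE ->; rewrite mulr0.
  exists 8 => x x0; rewrite mul0r subr0 (bigD1 (unit_class b a)) //= eqxx mulr1 big1 ?addr0; last first.
    by move=> g /negbTE ->; rewrite mulr0.
  by rewrite ger0_norm ?class_mass_ge0 // class_mass_le.
have muB F h : \sum_g F g = 0 -> \sum_g mu g * Lop F (h * g)%g = 0.
  move=> F0; apply: (muH (fun g => Lop F (h * g)%g) 0).
  have [C' hC'] := sum_von_mangoldt_Lop b1 (sum_shift0 h F0).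
  exists C' => x x0; rewrite mul0r subr0 sum_class_mass; apply: le_trans (hC' x x0).
  rewrite le_eqVlt; apply/orP; left; apply/eqP; congr `|_|; apply: eq_bigr => n _; congr (_ * _).
  rewrite /ext; case: ifP => // _; rewrite /Lop; congr harmonic_limit.
  by apply/funext => g; rewrite mulgA.
have muC F h : \sum_g F g = 0 -> (forall h, Lop F h = 0) -> \sum_g mu g * F (h * g)%g = - F h.
  move=> F0 L0; apply: muH.
  have L0' k : Lop (fun g => F (h * g)%g) k = 0.
    rewrite -(L0 (h * k)%g) /Lop; congr harmonic_limit.
    by apply/funext => g; rewrite mulgA.
  have [C' hC'] := sum_von_mangoldt_ker b1 (sum_shift0 h F0) L0'.
  exists C' => x x0; rewrite sum_class_mass mulNr opprK.
  by have := hC' x x0; rewrite mulg1.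
set n := #|{: {unit 'Z_b}}|.
have n0 : 0 < n%:R :> R by rewrite ltr0n; apply/card_gt0P; exists 1%g.
(* The point mass at 1, corrected to mean zero. Averaging its shifts against [mu] gives [phi], which
   is [mu] up to inversion and a constant. *)
pose f0 (g : {unit 'Z_b}) : R := (g == 1%g)%:R - n%:R^-1.
have f00 : \sum_g f0 g = 0.
  rewrite sumrB sumr_const (bigD1 1%g) //= ?eqxx big1 ?addr0; last by move=> g /negbTE ->.
  by rewrite -[X in _ - X](mulr_natr n%:R^-1 n) mulVf ?subrr // gt_eqF.
pose phi h := mu h^-1%g - n%:R^-1.
have phiE h : phi h = \sum_g mu g * f0 (h * g)%g.
  rewrite /f0; under eq_bigr do rewrite mulrBr; rewrite sumrB -mulr_suml mu1 mul1r /phi; congr (_ - _).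
  rewrite (bigD1 h^-1%g) //= mulgV eqxx mulr1 big1 ?addr0 // => g.
  by rewrite -eq_invg_mul eq_sym => /negbTE ->; rewrite mulr0.
have phi0 : \sum_g phi g = 0.
  by under eq_bigr do rewrite phiE; rewrite exchange_big big1 // => g _;
     rewrite -mulr_sumr; under eq_bigr do rewrite mul_unitC; rewrite sum_shift0 // mulr0.
(* [Lop] commutes with the average, and [mu] annihilates [Lop f0] by [muB]; thus [muC] applies to
   [phi] and gives the equation for [mu * mu]. *)
have Lphi h : Lop phi h = 0.
  rewrite -(muB f0 h f00) /Lop -harmonic_limit_sum //; last first.
    by move=> g; apply: (sum_shift0 (F := f0)).
  congr harmonic_limit; apply/funext => k; rewrite phiE; apply: eq_bigr => g _.
  by rewrite -!mulgA (mul_unitC k g).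
have conv h := muC phi h phi0 Lphi.
pose c g := 1 - n%:R * mu g.
have phic h : phi h = - c h^-1%g / n%:R by rewrite /phi /c; field; rewrite gt_eqF.
have c0 : \sum_g c g = 0.
  by rewrite sumrB -mulr_sumr mu1 mulr1 sumr_const subrr.
have cconv k : \sum_g c g * c (k * g^-1)%g = n%:R * c k.
  have := conv k^-1%g; rewrite phic invgK.
  under eq_bigr do rewrite phic invMg invgK.
  have -> : \sum_i mu i * (- c (i^-1 * k)%g / n%:R) = 
    \sum_i (c i * c (k * i^-1)%g / n%:R ^+ 2 - c (k * i^-1)%g / n%:R ^+ 2).
    apply: eq_bigr => i _; rewrite (mul_unitC i^-1%g).
    have -> : mu i = (1 - c i) / n%:R by rewrite /c; field; rewrite gt_eqF.
    by field; rewrite gt_eqF.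
  rewrite sumrB -!mulr_suml.
  have -> : \sum_i c (k * i^-1)%g = 0.
    by rewrite (reindex_inj invg_inj) /=; under eq_bigr do rewrite invgK; apply: sum_shift0.
  rewrite mul0r subr0 => e.
  have : \sum_i c i * c (k * i^-1)%g = - (- c k / n%:R) * n%:R ^+ 2.
    by rewrite -e divfK // sqrf_eq0 gt_eqF.
  by move=> ->; field; rewrite gt_eqF.
(* The upper bound is [0 <= mu]; the lower one is [mu g <= 2 / n], from the equation and the
   nonnegativity of [mu * mu]. *)
have c1 g : `|c g| <= 1.
  rewrite ler_norml /c; apply/andP; split; last first.
    by rewrite gerBl mulr_ge0 // ltW.
  have := conv g^-1%g.
  have -> : \sum_i mu i * phi (g^-1 * i)%g = \sum_i mu i * mu (i^-1 * g)%g - n%:R^-1.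
    under eq_bigr do rewrite /phi invMg invgK mulrBr; by rewrite sumrB -mulr_suml mu1 mul1r.
  rewrite /phi invgK => e.
  have h : 0 <= \sum_i mu i * mu (i^-1 * g)%g by apply: sumr_ge0 => i _; rewrite mulr_ge0.
  have h2 : mu g <= 2 / n%:R by lra.
  have : n%:R * mu g <= n%:R * (2 / n%:R) by rewrite ler_pM2l.
  rewrite mulrCA divff ?gt_eqF //; lra.
have ca1 : c (unit_class b a) = 1 by rewrite /c mua mulr0 subr0.
have [c11 cpm cM] := real_character c1 cconv ca1.
have cV g : c g^-1%g = c g.
  have := cM g g^-1%g; rewrite mulVg c11; case: (cpm g) => ->; lra.
(* Since [c] is invariant under inversion, [c = - n phi]; the decay of its harmonic sums is then the
   convergence rate of those of [phi], whose limit is 0. *)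
apply: (@monsky R (ext c) (2 * l1norm c) (n%:R * (2 * l1norm phi))).
- move=> i j; rewrite /ext coprimeMr.
  case: (boolP (coprime b i)) => ci /=; last by rewrite mul0r.
  by case: (boolP (coprime b j)) => cj /=; rewrite ?mulr0 // unit_classM.
- by rewrite /ext coprimen1 unit_class1.
- move=> i; rewrite /ext; case: ifP => _; last by constructor 1.
  by case: (cpm (unit_class b i)) => ->; [constructor 2 | constructor 3].
- by move=> j; apply: norm_sum_ext_window_le.
move=> N N0; have := harmonic_limitP b1 phi0 N0.
have -> : harmonic_limit phi = 0.
  by rewrite -[RHS](Lphi 1%g) /Lop; congr harmonic_limit; apply/funext => g; rewrite mul1g.
rewrite subr0.
have -> : \sum_(1 <= d < N) ext c d / d%:R = - n%:R * harmonic_sum phi N.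
  rewrite /harmonic_sum mulr_sumr; apply: eq_bigr => d _; rewrite /ext.
  case: ifP => _; last by rewrite !mul0r mulr0.
  by rewrite phic cV mulrA; congr (_ / _); field; rewrite gt_eqF.
by move=> h; rewrite normrM normrN (gtr0_norm n0) -mulrA ler_pM2l.
Qed.

Local Close Scope ring_scope.

(** * Orderings of the primes *)

Lemma ele_min (A : Type) (S : A -> Prop) (f : A -> enat) :
  (exists x, S x) -> exists x, S x /\ forall y, S y -> ele (f x) (f y).
Proof.
move=> [x0 Sx0].
have [[x [n [Sx fx]]]|nfin] := pselect (exists x n, S x /\ f x = Some n); last first.
  exists x0; split=> // y Sy.
  case E: (f y) => [n|]; last by case: (f x0).
  by exfalso; apply: nfin; exists y, n.
elim/ltn_ind: n x Sx fx => n IH x Sx fx.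
have [[y [m [mn [Sy fy]]]]|nlt] := pselect (exists y m, m < n /\ S y /\ f y = Some m).
  exact: (IH m mn y).
exists x; split=> // y Sy; rewrite fx; case fy: (f y) => [m|] //=.
by rewrite leqNgt; apply/negP => mn; apply: nlt; exists y, m.
Qed.

(** Needed because [some_b_ordering] is an [epsilon] term, about which nothing is known without
    existence. The recursion carries the list of earlier terms. *)
Lemma b_ordering_exists (S : int -> Prop) (b : nat) : (exists x, S x) -> exists a, b_ordering S b a.
Proof.
move=> S0.
have step (l : seq int) := ele_min (fun y => foldr eadd (Some 0) [seq ord b (y - z)%R | z <- l]) S0.
have [nxt nxtP] := choice step.
pose bs n := iter n (fun l => rcons l (nxt l)) [::].
pose a n := nxt (bs n).
have bsE n : bs n = mkseq a n by elim: n => // n IH; rewrite mkseqS -IH.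
have sumE i x : ordsum b a i x = foldr eadd (Some 0) [seq ord b (x - z)%R | z <- bs i].
  by rewrite bsE /mkseq -map_comp.
exists a; split=> [i|i _ x Sx]; first by have [] := nxtP (bs i).
rewrite !sumE; have [_ h] := nxtP (bs i); exact: h.
Qed.

Lemma ord_0 (b : nat) : ord b 0%R = None.
Proof.
rewrite /ord; case: ClassicalEpsilon.excluded_middle_informative => [//|[] k].
by rewrite dvdn0.
Qed.

Lemma ord_neq0 (b : nat) (x : int) : 1 < b -> x <> 0%R ->
  exists2 e, ord b x = Some e & forall k, (b ^ k %| `|x|%N) = (k <= e).
Proof.
move=> b1 x0; rewrite /ord; case: ClassicalEpsilon.excluded_middle_informative => H.
  have := H `|x|%N => /dvdn_leq; have := ltn_expl `|x|%N b1.
  by rewrite absz_gt0; move/eqP: x0 => -> h /(_ isT); rewrite leqNgt h.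
case: ex_minnP => e He emin; exists e.-1 => // k.
have e0 : 0 < e by case: e He {emin}; rewrite // expn0 dvd1n.
apply/idP/idP => [kx|ke].
  rewrite -ltnS prednK // ltnNge; apply/negP => ek.
  by move: He; rewrite (dvdn_trans (dvdn_exp2l b ek) kx).
have : ~~ (e <= k) by lia.
by apply: contraNT => /emin.
Qed.

Lemma sum_leq_bool (e M : nat) : e <= M -> \sum_(1 <= m < M.+1) (m <= e) = e.
Proof.
move=> eM; rewrite (big_cat_nat (n := e.+1)) //=.
rewrite (eq_big_nat _ _ (F2 := fun=> 1)); last by move=> m /andP[_]; rewrite ltnS => ->.
rewrite sum_nat_const_nat subn1 muln1 [X in _ + X]big1_seq ?addn0 // => m.
by rewrite mem_index_iota => /andP[_ /andP[em _]]; rewrite leqNgt em.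
Qed.

Lemma dvdn_dist_mod (d x y : nat) : (d %| `|(x%:Z - y%:Z)%R|%N) = (y == x %[mod d]).
Proof.
have -> : (d %| `|(x%:Z - y%:Z)%R|%N) = (d%:Z %| (x%:Z - y%:Z)%R)%Z by rewrite dvdzE.
by rewrite -eqz_mod_dvd !modz_nat eqz_nat eq_sym.
Qed.

Lemma foldr_eadd_Some (A : eqType) (s : seq A) (f : A -> enat) (g : A -> nat) :
  (forall j, j \in s -> f j = Some (g j)) ->
  foldr eadd (Some 0) (map f s) = Some (\sum_(j <- s) g j).
Proof.
elim: s => [|j s IH] H /=; first by rewrite big_nil.
rewrite big_cons H ?mem_head // IH // => i si.
by apply: H; rewrite inE si orbT.
Qed.

Lemma foldr_eadd_None (A : eqType) (s : seq A) (f : A -> enat) (j : A) :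
  j \in s -> f j = None -> foldr eadd (Some 0) (map f s) = None.
Proof.
elim: s => // i s IH /=; rewrite inE => /orP[/eqP <-|js] fj; first by rewrite fj.
by rewrite IH //; case: (f i).
Qed.

(** * Counting earlier terms in residue classes modulo powers of [b] *)

Definition cnt (b : nat) (p : nat -> nat) (m r k : nat) : nat :=
  \sum_(0 <= j < k) (p j == r %[mod b ^ m]).

Lemma ordsum_None (b : nat) (p : nat -> nat) (k q j : nat) : j < k -> p j = q ->
  ordsum b (fun j => Posz (p j)) k (Posz q) = None.
Proof.
move=> jk pq; apply: (foldr_eadd_None (j := j)); first by rewrite mem_iota.
by rewrite pq GRing.subrr ord_0.
Qed.

(** Each order is the number of [m >= 1] with [b ^ m] dividing the difference; exchange the two
    sums. [M] is any level beyond which [q] meets no earlier term. *)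
Lemma ordsum_Some (b : nat) (p : nat -> nat) (k q M : nat) : 1 < b ->
  (forall j, j < k -> p j != q %[mod b ^ M.+1]) ->
  ordsum b (fun j => Posz (p j)) k (Posz q) = Some (\sum_(1 <= m < M.+1) cnt b p m q k).
Proof.
move=> b1 H; rewrite /cnt exchange_big /=.
rewrite /index_iota subn0; apply: foldr_eadd_Some => j; rewrite mem_iota add0n => jk.
have npq : (Posz q - Posz (p j))%R <> 0%R.
  by move/GRing.Theory.subr0_eq => [e]; have := H j jk; rewrite e eqxx.
have [e -> eP] := ord_neq0 b1 npq; congr Some.
rewrite (eq_bigr (fun m => nat_of_bool (m <= e))); last first.
  by move=> m _; rewrite -eP dvdn_dist_mod.
rewrite [RHS]sum_leq_bool // leqNgt -eP dvdn_dist_mod; exact: H.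
Qed.

Lemma modn_expn_le (b m M x y : nat) : m <= M -> x = y %[mod b ^ M] -> x = y %[mod b ^ m].
Proof.
move=> mM e; rewrite -(modn_dvdm x (dvdn_exp2l b mM)) e modn_dvdm //.
by apply: dvdn_exp2l.
Qed.

Lemma cnt_mod (b : nat) (p : nat -> nat) (m r r' k : nat) : r = r' %[mod b ^ m] ->
  cnt b p m r k = cnt b p m r' k.
Proof. by move=> e; rewrite /cnt e. Qed.

Lemma cntS (b : nat) (p : nat -> nat) (m r k : nat) :
  cnt b p m r k.+1 = cnt b p m r k + (p k == r %[mod b ^ m]).
Proof. by rewrite /cnt big_nat_recr. Qed.

Lemma coprime_expn_mod (b m x y : nat) : 0 < m -> x = y %[mod b ^ m] -> coprime b x = coprime b y.
Proof.
move=> m0 e; have := modn_expn_le m0 e; rewrite expn1 => e1.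
by rewrite -coprime_modr e1 coprime_modr.
Qed.

Lemma sum_coprime_blocks (b c : nat) : \sum_(0 <= r < c * b) coprime b r = c * totient b.
Proof.
elim: c => [|c IH]; first by rewrite big_geq.
rewrite mulSn addnC (big_cat_nat (n := c * b)) ?leq_addr //= IH mulSn addnC; congr (_ + _).
rewrite -{1}[c * b]add0n big_addn addKn totient_count_coprime.
by apply: eq_bigr => r _; rewrite -coprime_modr addnC modnMDl coprime_modr.
Qed.

Lemma sum_cnt_coprime (b : nat) (p : nat -> nat) (m k : nat) : 0 < b -> 0 < m ->
  \sum_(0 <= r < b ^ m | coprime b r) cnt b p m r k = \sum_(0 <= j < k) coprime b (p j).
Proof.
move=> b0 m0; rewrite /cnt exchange_big /=; apply: eq_bigr => j _.
have pb : 0 < b ^ m by rewrite expn_gt0 b0.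
rewrite big_mkcond (bigD1_seq (p j %% b ^ m)) ?iota_uniq //=; last first.
  by rewrite mem_index_iota ltn_pmod.
rewrite (coprime_expn_mod (y := p j) m0) ?modn_mod // eqxx.
rewrite big1_seq ?addn0; first by case: coprime.
move=> r /andP[rp]; rewrite mem_index_iota => /andP[_ rb]; case: ifP => // _.
by rewrite [r %% _]modn_small // eq_sym (negbTE rp).
Qed.

Lemma sum_cnt_children (b : nat) (p : nat -> nat) (M r k : nat) : 0 < b -> r < b ^ M ->
  \sum_(0 <= i < b) cnt b p M.+1 (r + i * b ^ M) k <= cnt b p M r k.
Proof.
move=> b0 rM; rewrite /cnt exchange_big /=; apply: leq_sum => j _.
have small i : i < b -> r + i * b ^ M < b ^ M.+1.
  move=> ib; rewrite expnS; apply: (@leq_trans (i.+1 * b ^ M)); last by rewrite leq_mul2r ib orbT.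
  by rewrite mulSn ltn_add2r.
have [[i ib hi]|no] := pselect (exists2 i, i < b & p j = r + i * b ^ M %[mod b ^ M.+1]).
  rewrite (bigD1_seq i) ?iota_uniq ?mem_index_iota //= hi eqxx big1_seq ?addn0.
    have := modn_expn_le (leqnSn M) hi => ->.
    by rewrite addnC modnMDl eqxx.
  move=> i' /andP[ii]; rewrite mem_index_iota => /andP[_ i'b].
  rewrite !modn_small ?small // eqn_add2l eqn_mul2r (eq_sym i) (negbTE ii) orbF.
  by rewrite expn_eq0; case: (b) b0.
rewrite big1_seq // => i; rewrite mem_index_iota => /andP[_ /andP[_ ib]].
by case: eqP => // hi; exfalso; apply: no; exists i.
Qed.

Lemma sum_le_exists (n c : nat) (P : pred nat) (f : nat -> nat) :
  0 < \sum_(0 <= i < n) P i -> \sum_(0 <= i < n | P i) f i <= c ->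
  exists2 i, i < n & P i /\ f i <= c %/ \sum_(0 <= j < n) P j.
Proof.
set N := \sum_(0 <= i < n) P i => N0 sc; apply: contrapT => no.
have : N * (c %/ N).+1 <= \sum_(0 <= i < n | P i) f i.
  rewrite /N big_distrl /= [X in _ <= X]big_mkcond big_seq [X in _ <= X]big_seq.
  apply: leq_sum => i; rewrite mem_index_iota => /andP[_ ni].
  case Pi: (P i); last by rewrite mul0n.
  rewrite mul1n ltnNge; apply/negP => fi; apply: no; exists i => //.
have := ltn_ceil c N0; rewrite mulnC; lia.
Qed.

(** The divisor is the number of units mod [b ^ m], so [m] starts at 1, one more than the index in
    the final formula. *)
Definition floor_term (b n m : nat) : nat := n %/ (b ^ m.-1 * totient b).

(** Pigeonhole among the unit classes mod [b], then among the [b] lifts at each level. The bounds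
    compose since nested floors satisfy floor(floor(n/u)/b) = floor(n/(ub)). *)
Lemma low_path (b : nat) (p : nat -> nat) (k n M : nat) : 1 < b ->
  n = \sum_(0 <= j < k) coprime b (p j) -> 0 < M ->
  exists2 r, r < b ^ M & coprime b r /\
    forall m, 0 < m <= M -> cnt b p m r k <= floor_term b n m.
Proof.
move=> b1 nE; have b0 : 0 < b by lia.
elim: M => // M IH _; have [->|M0] := posnP M.
  have cE : \sum_(0 <= i < b ^ 1) coprime b i = totient b by rewrite expn1 totient_count_coprime.
  have := @sum_le_exists (b ^ 1) n (coprime b) (fun r => cnt b p 1 r k).
  rewrite cE totient_gt0 b0 sum_cnt_coprime // nE => /(_ isT (leqnn _)) [r rb [cr h]].
  exists r => //; split=> // m /andP[m0 m1]; have -> : m = 1 by lia.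
  by rewrite /floor_term expn0 mul1n.
have [r rM [cr hr]] := IH M0.
have bE : \sum_(0 <= i < b) xpredT i = b by rewrite sum_nat_const_nat subn0 muln1.
have := @sum_le_exists b (cnt b p M r k) xpredT (fun i => cnt b p M.+1 (r + i * b ^ M) k).
rewrite bE => /(_ b0 (sum_cnt_children _ _ b0 rM)) [i ib [_ hi]].
have e : r + i * b ^ M = r %[mod b ^ M] by rewrite addnC modnMDl.
exists (r + i * b ^ M).
  rewrite expnS; apply: (@leq_trans (i.+1 * b ^ M)); last by rewrite leq_mul2r ib orbT.
  by rewrite mulSn ltn_add2r.
split; first by rewrite (coprime_expn_mod M0 e).
move=> m /andP[m0]; rewrite leq_eqVlt => /orP[/eqP ->|mM].
  apply: leq_trans hi _; rewrite /floor_term /=.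
  have -> : b ^ M * totient b = b ^ M.-1 * totient b * b by rewrite -{1}(prednK M0) expnS; lia.
  by rewrite divnMA leq_div2r //; apply: hr; rewrite M0 leqnn.
rewrite (cnt_mod _ _ (modn_expn_le _ e)) //; apply: hr; rewrite m0 //.
Qed.

(* Invariant of the first [k] terms of a b-ordering [p] of the primes. *)
Definition balanced (b : nat) (p : nat -> nat) (k : nat) : Prop :=
  [/\ forall m r r', 0 < m -> coprime b r -> coprime b r' -> cnt b p m r k <= (cnt b p m r' k).+1,
      forall q, q \in primes b -> \sum_(0 <= j < k) (p j == q) <= 1 &
      (exists2 q, q \in primes b & forall j, j < k -> p j != q) ->
        forall r, coprime b r -> cnt b p 1 r k <= 1].

Lemma balanced0 b p : balanced b p 0.
Proof. by split=> *; rewrite /cnt big_geq. Qed.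

Lemma prime_special_or_coprime b q : 0 < b -> prime q -> (q \in primes b) = ~~ coprime b q.
Proof. by move=> b0 pq; rewrite mem_primes pq b0 /= coprime_sym prime_coprime // negbK. Qed.

(** Hence a prime divisor of [b] not yet used has cost 0. *)
Lemma special_eq b q q' : q \in primes b -> prime q' -> q' = q %[mod b] -> q' = q.
Proof.
rewrite mem_primes => /and3P[pq b0 qb] pq' e.
have : q %| q' by rewrite /dvdn -(modn_dvdm q' qb) e modn_dvdm // modnn.
by rewrite dvdn_prime2 // => /eqP.
Qed.

(* The last three hypotheses are what the greedy choice of [p k] provides. *)
Lemma balancedS b p k : 1 < b -> (forall j, prime (p j)) -> balanced b p k ->
  (p k \in primes b -> forall j, j < k -> p j != p k) ->
  (coprime b (p k) -> forall m r, 0 < m -> coprime b r -> cnt b p m (p k) k <= cnt b p m r k) ->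
  ((exists2 q, q \in primes b & forall j, j < k -> p j != q) -> cnt b p 1 (p k) k = 0) ->
  balanced b p k.+1.
Proof.
move=> b1 pp [B1 B2 B3] H1 H2 H3; have b0 : 0 < b by lia.
split.
- move=> m r r' m0 cr cr'; rewrite !cntS; case: (eqVneq (p k %% b ^ m) (r %% b ^ m)) => [e|_].
    have ck : coprime b (p k) by rewrite (coprime_expn_mod m0 e).
    by have := H2 ck m r' m0 cr'; rewrite (cnt_mod _ _ e); lia.
  by have := B1 m r r' m0 cr cr'; lia.
- move=> q qb; rewrite big_nat_recr //=; have [e|_] := eqVneq (p k) q; last by rewrite addn0 B2.
  rewrite big1_seq // => j; rewrite mem_index_iota => /andP[_ /andP[_ jk]].
  by rewrite -e (negbTE (H1 _ j jk)) // e.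
move=> [q qb hq] r cr.
have un : exists2 q, q \in primes b & forall j, j < k -> p j != q.
  by exists q => // j jk; apply: hq; lia.
rewrite cntS; case: (eqVneq (p k %% b ^ 1) (r %% b ^ 1)) => [e|_]; last by rewrite addn0 B3.
by rewrite -(cnt_mod _ _ e) H3.
Qed.

(** * From balanced counts to the exponents *)

Lemma nsum_inf_Some (f : nat -> nat) (M : nat) : (forall i, M <= i -> f i = 0) ->
  nsum_inf f = Some (\sum_(0 <= i < M) f i).
Proof.
move=> fM; rewrite /nsum_inf; case: ClassicalEpsilon.excluded_middle_informative => [H|[]]; last by exists M.
case: (ClassicalEpsilon.constructive_indefinite_description _ H) => N /= fN; congr Some; rewrite -(big_mkord xpredT f).
have aux A B : A <= B -> (forall i, A <= i -> f i = 0) ->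
    \sum_(0 <= i < A) f i = \sum_(0 <= i < B) f i.
  move=> AB fA; rewrite [RHS](big_cat_nat (n := A)) //= [X in _ + X]big1_seq ?addn0 // => i.
  by rewrite mem_index_iota => /andP[_ /andP[Ai _]]; apply: fA.
by have [NM|/ltnW MN] := leqP N M; [apply: aux | apply/esym/aux].
Qed.

Lemma nsum_inf_floor (b n M : nat) : n < b ^ M * totient b -> 0 < b ->
  nsum_inf (fun i => n %/ (b ^ i * totient b)) = Some (\sum_(1 <= m < M.+1) floor_term b n m).
Proof.
move=> nM b0; rewrite (nsum_inf_Some (M := M)); last first.
  move=> i Mi; rewrite divn_small //; apply: leq_trans nM _.
  by rewrite leq_mul2r leq_pexp2l ?orbT.
by rewrite big_add1.
Qed.

Lemma cnt_anti (b : nat) (p : nat -> nat) (m M r k : nat) : m <= M ->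
  cnt b p M r k <= cnt b p m r k.
Proof.
move=> mM; apply: leq_sum => j _; case: eqP => // e.
by rewrite (modn_expn_le mM e) eqxx.
Qed.

Lemma separating_exponent (b : nat) (p : nat -> nat) (q k : nat) : 1 < b ->
  (forall j, j < k -> p j != q) ->
  exists M0, forall M, M0 <= M -> forall j, j < k -> p j != q %[mod b ^ M.+1].
Proof.
move=> b1 hq; exists (q + \sum_(0 <= j < k) p j) => M hM j jk.
have pj : p j <= \sum_(0 <= j < k) p j.
  by rewrite (bigD1_seq j) ?iota_uniq ?mem_index_iota //= leq_addr.
have h := ltn_expl M.+1 b1.
by rewrite !modn_small ?hq //; lia.
Qed.

Lemma special_count (b : nat) (p : nat -> nat) (k : nat) :
  \sum_(0 <= j < k) (p j \in primes b) = \sum_(q <- primes b) \sum_(0 <= j < k) (p j == q).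
Proof.
rewrite exchange_big /=; apply: eq_bigr => j _.
case pb: (p j \in primes b).
  rewrite (bigD1_seq (p j)) ?primes_uniq //= eqxx big1 // => q.
  by rewrite eq_sym => /negbTE ->.
rewrite big1_seq // => q /andP[_ qb]; case: eqP => // e.
by rewrite e qb in pb.
Qed.

Lemma count_split (b : nat) (p : nat -> nat) (k : nat) : 0 < b -> (forall j, prime (p j)) ->
  \sum_(0 <= j < k) (p j \in primes b) + \sum_(0 <= j < k) coprime b (p j) = k.
Proof.
move=> b0 pp; rewrite -big_split /= (eq_bigr (fun=> 1)).
  by rewrite sum_nat_const_nat subn0 muln1.
by move=> j _; rewrite prime_special_or_coprime //; case: coprime.
Qed.

(** Every unit class holds at most [(cnt b p m r k).+1] terms, and the class of [r] one fewer, so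
    the total is strictly below the number of classes times that bound. *)
Lemma floor_term_le_cnt (b : nat) (p : nat -> nat) (k m r : nat) : 1 < b -> balanced b p k ->
  0 < m -> coprime b r -> floor_term b (\sum_(0 <= j < k) coprime b (p j)) m <= cnt b p m r k.
Proof.
move=> b1 [B1 _ _] m0 cr; have b0 : 0 < b by lia.
have pb : 0 < b ^ m by rewrite expn_gt0 b0.
have cN : \sum_(0 <= i < b ^ m) coprime b i = b ^ m.-1 * totient b.
  by rewrite -{1}(prednK m0) expnSr sum_coprime_blocks.
rewrite /floor_term -cN -ltnS ltn_divLR; last by rewrite cN muln_gt0 expn_gt0 b0 totient_gt0 b0.
rewrite -(sum_cnt_coprime p k b0 m0) mulnC big_distrl /= big_mkcond.
have rb : r %% b ^ m \in index_iota 0 (b ^ m) by rewrite mem_index_iota ltn_pmod.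
have cr' : coprime b (r %% b ^ m) by rewrite (coprime_expn_mod (y := r) m0) ?modn_mod.
rewrite (bigD1_seq _ rb) ?iota_uniq //= cr' [X in _ < X](bigD1_seq _ rb) ?iota_uniq //= cr' mul1n.
rewrite (cnt_mod _ _ (modn_mod r (b ^ m))) -addSn leq_add // leq_sum // => i _.
by case ci: (coprime b i) => //; rewrite mul1n B1.
Qed.

Lemma greedy_step (b : nat) (p : nat -> nat) (k : nat) : 1 < b -> (forall j, prime (p j)) ->
  balanced b p k ->
  (forall q, prime q -> ele (ordsum b (fun j => Posz (p j)) k (Posz (p k)))
                            (ordsum b (fun j => Posz (p j)) k (Posz q))) ->
  ordsum b (fun j => Posz (p j)) k (Posz (p k)) =
    nsum_inf (fun i => (k - omega b) %/ (b ^ i * totient b)) /\ balanced b p k.+1.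
Proof.
move=> b1 pp bal greedy; have b0 : 0 < b by lia.
have phi0 : 0 < totient b by rewrite totient_gt0.
set E := ordsum _ _ _ _ in greedy *.
have fresh n : E = Some n -> forall j, j < k -> p j != p k.
  move=> En j jk; apply/eqP => e.
  by move: En; rewrite /E (ordsum_None b jk e).
have kE := count_split k b0 pp; have [B1 B2 B3] := bal.
set S := \sum_(0 <= j < k) (p j \in primes b) in kE.
set n := \sum_(0 <= j < k) coprime b (p j) in kE.
have SE : S = \sum_(q <- primes b) \sum_(0 <= j < k) (p j == q) := special_count b p k.
have [un|full] := pselect (exists2 q, q \in primes b & forall j, j < k -> p j != q).
  have [q qb hq] := un.
  have Eq : ordsum b (fun j => Posz (p j)) k (Posz q) = Some 0.
    rewrite (ordsum_Some (M := 0) b1) ?big_geq // => j jk.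
    rewrite expn1; apply/eqP => e.
    by have := hq j jk; rewrite (special_eq qb (pp j) e) eqxx.
  have E0 : E = Some 0.
    have := greedy q; rewrite Eq => /(_ _); case: E {fresh greedy} => [[|m]|] //= h.
      by have := h ltac:(by move: qb; rewrite mem_primes => /and3P[]).
    by have := h ltac:(by move: qb; rewrite mem_primes => /and3P[]).
  have fr := fresh 0 E0.
  have c0 m : 0 < m -> cnt b p m (p k) k = 0.
    move=> m0; have [M0 hM0] := separating_exponent b1 fr.
    have := ordsum_Some (M := M0.+1) b1 (hM0 _ (leqnSn _)); rewrite -/E E0 => -[/esym].
    rewrite big_ltn // => h; apply/eqP; rewrite -leqn0.
    by apply: leq_trans (cnt_anti _ _ _ _ m0) _; lia.
  split; last first.
    apply: balancedS => // [_ m r m0 _|_]; by rewrite c0.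
  rewrite E0 (nsum_inf_floor (M := 0)) // ?big_geq // expn0 mul1n.
  have Sle : S < omega b.
    rewrite SE (bigD1_seq q) ?primes_uniq //= big1_seq ?add0n; last first.
      by move=> j; rewrite mem_index_iota => /andP[_ /andP[_ jk]]; rewrite (negbTE (hq j jk)).
    apply: (@leq_ltn_trans (\sum_(i <- primes b | i != q) 1)).
      by rewrite big_seq_cond [X in _ <= X]big_seq_cond; apply: leq_sum => i /andP[/B2].
    have : \sum_(i <- primes b) 1 = omega b by rewrite sum1_size.
    by rewrite (bigD1_seq q) ?primes_uniq //= => <-.
  have nle : n <= totient b.
    rewrite /n -(sum_cnt_coprime p k b0 (ltnSn 0)) expn1 totient_count_coprime big_mkcond.
    by apply: leq_sum => r _; case cr: (coprime b r) => //; apply: B3.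
  lia.
have chosen q : q \in primes b -> exists2 j, j < k & p j = q.
  move=> qb; apply: contrapT => no; apply: full; exists q => // j jk.
  by apply/eqP => e; apply: no; exists j.
have SO : S = omega b.
  rewrite SE /omega -sum1_size; apply: eq_big_seq => q qb; apply/eqP; rewrite eqn_leq B2 //=.
  have [j jk e] := chosen q qb.
  by rewrite (bigD1_seq j) ?iota_uniq ?mem_index_iota //= e eqxx leq_addr.
have nE : n = k - omega b by lia.
rewrite -nE.
pose M := n.
have big m : M < m -> floor_term b n m = 0.
  move=> Mm; rewrite /floor_term divn_small //.
  have h1 := ltn_expl m.-1 b1; have h2 : b ^ m.-1 <= b ^ m.-1 * totient b by rewrite leq_pmulr.
  rewrite /M in Mm; lia.
(* The path goes one level past [M], where the floor is 0: a prime in this class is congruent to no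
   earlier term mod [b ^ M.+1]. *)
have [r rM [cr hr]] := low_path (p := p) (k := k) b1 (erefl n) (ltn0Sn M).
have bM1 : 1 < b ^ M.+1 by rewrite expnS (leq_trans b1) // leq_pmulr // expn_gt0 b0.
have crM : coprime (b ^ M.+1) r by rewrite coprimeXl.
have [q pq qr] := dirichlet (Rdefinitions.R : realType) bM1 crM.
have hq m : 0 < m <= M.+1 -> cnt b p m q k <= floor_term b n m.
  move=> mM; have /andP[_ mM'] := mM.
  by rewrite (cnt_mod _ _ (modn_expn_le mM' qr)); apply: hr.
have q0 j : j < k -> p j != q %[mod b ^ M.+1].
  move=> jk; apply/negP => e.
  have := hq M.+1 ltac:(by rewrite ltn0Sn leqnn); rewrite big // /cnt.
  by rewrite (bigD1_seq j) ?iota_uniq ?mem_index_iota //= e.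
have Eq := ordsum_Some b1 q0.
have := greedy q pq; rewrite Eq.
case EE : E => [e|] //= eq.
have fr := fresh e EE.
have ck : coprime b (p k).
  rewrite -[coprime _ _]negbK -prime_special_or_coprime //; apply/negP => sp.
  by have [j jk] := chosen _ sp; apply/eqP; apply: fr.
have [M0 hM0] := separating_exponent b1 fr.
pose M2 := maxn M M0.
have E2 := ordsum_Some b1 (hM0 M2 (leq_maxr _ _)).
have eE : e = \sum_(1 <= m < M2.+1) cnt b p m (p k) k by move: EE; rewrite /E E2 => -[].
have lo m : 0 < m -> floor_term b n m <= cnt b p m (p k) k.
  by move=> m0; apply: floor_term_le_cnt.
have up : e <= \sum_(1 <= m < M2.+1) floor_term b n m.
  apply: leq_trans eq _; rewrite [X in _ <= X](big_cat_nat (n := M.+1)) ?ltnS ?leq_maxl //=.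
  apply: leq_trans (leq_addr _ _).
  rewrite big_seq [X in _ <= X]big_seq; apply: leq_sum => m; rewrite mem_index_iota => /andP[m0 mM].
  by apply: hq; rewrite m0 ltnW.
(* Each count is at least its floor and the total is at most the sum of the floors, so no single
   excess is possible. *)
have eqm m : 0 < m <= M2 -> cnt b p m (p k) k = floor_term b n m.
  move=> /andP[m0 mM]; apply/eqP; rewrite eqn_leq lo // andbT leqNgt; apply/negP => lt.
  move: up; rewrite leqNgt => /negP; apply; rewrite eE.
  have mi : m \in index_iota 1 M2.+1 by rewrite mem_index_iota m0.
  rewrite (bigD1_seq m mi) ?iota_uniq //= [X in _ < X](bigD1_seq m mi) ?iota_uniq //= -addSn.
  apply: leq_add => //; rewrite big_seq_cond [X in _ <= X]big_seq_cond.
  by apply: leq_sum => i; rewrite mem_index_iota => /andP[/andP[i0 _] _]; apply: lo.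
have zero m : M2 < m -> cnt b p m (p k) k = 0.
  move=> mM; apply: big1_seq => j; rewrite mem_index_iota => /andP[_ /andP[_ jk]].
  have := hM0 m.-1 ltac:(rewrite /M2 in mM; lia) j jk.
  by rewrite prednK; [move/negbTE => -> | lia].
split.
  rewrite (nsum_inf_floor (M := M2)) //; last first.
    have := ltn_expl M2 b1; have : b ^ M2 <= b ^ M2 * totient b by rewrite leq_pmulr.
    by rewrite /M2 /M; lia.
  rewrite eE; congr Some; apply: eq_big_nat => m /andP[m0 mM]; apply: eqm.
  by rewrite m0 -ltnS.
apply: balancedS => // _ m r' m0 cr'.
have [mM|mM] := leqP m M2; last by rewrite zero.
by rewrite eqm ?m0 // floor_term_le_cnt.
Qed.

Lemma alpha_primes (b k : nat) : 1 < b ->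
  alpha primesZ b k = nsum_inf (fun i => (k - omega b) %/ (b ^ i * totient b)).
Proof.
move=> b1; rewrite /alpha; set a := some_b_ordering _ _.
have [Sa greedy] : b_ordering primesZ b a.
  apply: ClassicalEpsilon.epsilon_spec; apply: b_ordering_exists.
  by exists (Posz 2), 2.
have [p hp] := choice Sa.
have aE : a = fun j => Posz (p j) by apply/funext => j; have [] := hp j.
have pp j : prime (p j) by have [] := hp j.
have gr i q : prime q -> ele (ordsum b (fun j => Posz (p j)) i (Posz (p i)))
                             (ordsum b (fun j => Posz (p j)) i (Posz q)).
  (* At index 0 a b-ordering imposes no minimality, but both sums are empty. *)
  move=> pq; case: (posnP i) => [->|i0] //.
  by have := greedy i i0 (Posz q); rewrite aE; apply; exists q.
have bal i : balanced b p i.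
  elim: i => [|i IH]; first exact: balanced0.
  by have [] := greedy_step b1 pp IH (gr i).
by rewrite aE; have [] := greedy_step b1 pp (bal k) (gr k).
Qed.

(** A crude bound making the product finite. If q^e exactly divides [b], then (q-1) q^(e-1) <= k, so
    both [q] and [e] are at most k+1. *)
Lemma totient_bound (b k : nat) : 0 < b -> totient b <= k -> b <= (k.+1)`! ^ k.+1.
Proof.
move=> b0 bk; apply: dvdn_leq; first by rewrite expn_gt0 fact_gt0.
apply/dvdn_partP => // q; rewrite mem_primes => /and3P[pq _ qb].
have q1 := prime_gt1 pq; rewrite p_part; set e := logn q b.
have e0 : 0 < e by rewrite logn_gt0 mem_primes pq b0.
have h : q.-1 * q ^ e.-1 <= k.
  apply: leq_trans bk; have [m cm bE] := pfactor_coprime pq b0.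
  have m0 : 0 < m by move: b0; rewrite bE muln_gt0 => /andP[].
  rewrite [X in totient X]bE totient_coprime; last by rewrite coprime_sym coprimeXl.
  by rewrite totient_pfactor // leq_pmull // totient_gt0.
have h1 : q <= k.+1.
  have : q.-1 <= q.-1 * q ^ e.-1 by rewrite leq_pmulr // expn_gt0 prime_gt0.
  lia.
have h2 : e <= k.+1.
  have := ltn_expl e.-1 q1; have : q ^ e.-1 <= q.-1 * q ^ e.-1 by rewrite leq_pmull //; lia.
  lia.
apply: (@dvdn_trans ((k.+1)`! ^ e)); last exact: dvdn_exp2l.
by apply: dvdn_exp2r; rewrite dvdn_fact // h1 prime_gt0.
Qed.

Theorem theorem3p9 (T : nat -> bool) (HT : forall b, T b -> (0 < b)%N) (k : nat) :
  exists n : nat,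
    genfact_eq primesZ T k n /\
    fprod_eq (fun b => T b && (totient b + omega b <= k)%N)
      (fun b => epow b (nsum_inf (fun i => ((k - omega b) %/ (b ^ i * totient b))%N)))
      n.
Proof.
set g := fun b => epow b _.
have gE b : T b -> epow b (alpha primesZ b k) = g b.
  move=> Tb; rewrite /g; have [b1|b1] := ltnP 1 b; first by rewrite alpha_primes.
  have -> : b = 1 by have := HT b Tb; lia.
  (* For [b = 1] the two exponents may differ, but every power of 1, the infinite one included, is
     1. *)
  have e1 x : epow 1 x = 1 by case: x => [m|] //=; rewrite exp1n.
  by rewrite !e1.
pose P b := T b && (totient b + omega b <= k).
pose s := [seq b <- iota 0 ((k.+1)`! ^ k.+1).+1 | P b].
have mem_s b : P b -> b \in s.
  move=> Pb; rewrite mem_filter Pb mem_iota add0n ltnS /=; case/andP: Pb => Tb hb.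
  by apply: totient_bound; [apply: HT | lia].
have Ps : all P s by apply/allP => b; rewrite mem_filter => /andP[].
exists (\prod_(b <- s) g b); split; last first.
  by exists s; split=> //; rewrite ?filter_uniq ?iota_uniq // => b /mem_s.
exists s; split.
- by rewrite filter_uniq ?iota_uniq.
- by apply: sub_all Ps => b /andP[].
- move=> b Tb; rewrite gE // => gb; apply: mem_s; rewrite /P Tb /= leqNgt.
  apply: contra gb => lt; have b0 := HT b Tb.
  (* Outside the index condition all floors vanish, so the factor is [b ^ 0 = 1]. *)
  have small : k - omega b < b ^ 0 * totient b.
    by rewrite expn0 mul1n; move: b0; rewrite -totient_gt0; lia.
  by rewrite /g (nsum_inf_floor small b0) big_geq.
by apply: eq_big_seq => b; rewrite mem_filter => /andP[/andP[Tb _] _]; rewrite gE.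
Qed.
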